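(* Let $\mathbb{F}_q$ be a finite field with $q$ elements, $\alpha$ a generator of $\mathbb{F}_q^*$, $m$ a positive divisor of $q-1$, $n$ a positive integer, and let $f(x)=x^nh\big(x^{\frac{q-1}{m}}\big)\in\mathbb{F}_q[x]$ be a polynomial with index $m$ which is $m$-nice over $\mathbb{F}_q$. Write $\frac{q-1}{m}=\nu\omega$ where $\omega$ is the greatest divisor of $\frac{q-1}{m}$ relatively prime to $n$, and let $\omega'$ be the greatest divisor of $q-1$ relatively prime to $n$. Let $S_1,\dots,S_t\subseteq\mu_m$ be sets such that $\mu_m\setminus\psi_f^{-\infty}(0)=S_1\cup\dots\cup S_t$ and, for each $i$, the functional graph of $\psi_f$ on $S_i$ is a single directed cycle of length $k_i$. For each $i=1,\dots,t$, let $\xi_i\in S_i$ and let $\ell_i,r_i$ be integers with $\xi_i=\alpha^{\frac{q-1}{m}r_i}$ and $\alpha^{\ell_i}=\prod_{j=0}^{k_i-1}h\big(\psi_f^{(j)}(\xi_i)\big)^{n^{k_i-j-1}}$. Then $$\mathcal{G}^{(1)}_{f/\mathbb{F}_q}=\bigoplus_{\substack{i=1,\dots,t\\ u\mid \operatorname{ord}_{\omega'(n^{k_i}-1)}(n^{k_i})}}\left(\frac{\sum_{d\mid u}\mu(\tfrac{u}{d})\tau_i(d)}{u}\times\operatorname{Cyc}\big(k_iu,\mathcal T_{\gcd_n(\nu)}\big)\right),$$ where $$\tau_i(d)=\begin{cases}\gcd\big(\tfrac{q-1}{m},n^{dk_i}-1\big),&\text{if }\gcd\big(q-1,(n^{dk_i}-1)m\big)\mid\Big(\ell_i\tfrac{n^{dk_i}-1}{n^{k_i}-1}+r_i(n^{dk_i}-1)\Big);\\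 0,&\text{otherwise.}\end{cases}$$
   Context: Graphs are considered up to isomorphism. $\mu_m$ is the set of $m$-th roots of unity in $\mathbb{F}_q$; $\mu(\cdot)$ is the Möbius function; $\operatorname{ord}_N(b)$ is the multiplicative order of $b$ modulo $N$. Every $f\in\mathbb{F}_q[x]$ with $f(0)=0$ can be written uniquely as $f(x)=x^nh(x^{\frac{q-1}{m}})$ with $h(0)\ne0$ and $m$ minimal; $m$ is the index of $f$. Set $\psi_f(x)=x^nh(x)^{\frac{q-1}{m}}$, with iterates $\psi_f^{(j)}$. $f$ is $m$-nice if $\psi_f$ restricted to $\mu_m\setminus\psi_f^{-1}(0)$ is an injective map into $\mu_m$. $\psi_f^{-\infty}(0)=\{\gamma\in\mu_m:\psi_f^{(i)}(\gamma)=0\text{ for some positive integer }i\}$. The functional graph $\mathcal G(f/\mathbb{F}_q)$ has vertex set $\mathbb{F}_q$ and edges $(a,f(a))$; $\mathcal G^{(1)}_{f/\mathbb{F}_q}$ is the union of its connected components not containing $0$. A rooted tree has all edges directed toward the root; $\bullet$ is the one-vertex tree. $\operatorname{Cyc}(k,\mathcal T)$ is a directed cycle of length $k$ each of whose vertices is the root of a tree isomorphic to $\mathcal T$. $\oplus$ is disjoint union, $k\times\mathcal G=\bigoplus_{i=1}^k\mathcal G$, and $\langle\mathcal T_1\oplus\dots\oplus\mathcal T_s\rangle$ is the rooted tree whose root's children are roots of copies of $\mathcal T_1,\dots,\mathcal T_s$. For a positive integer $v$, $\gcd_n(v)=(v_1,\dots,v_s)$ with $v_i=\gcd(n^i,v)/\gcd(n^{i-1},v)$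 and $s$ the least positive integer with $v_s=1$. For a non-increasing sequence of positive integers $V=(v_1,\dots,v_D)$, put $v_i=v_D$ for $i\ge D+1$, $\mathcal T_V^0=\bullet$, $\mathcal T_V^k=\big\langle v_k\times\mathcal T_V^{k-1}\oplus\bigoplus_{i=1}^{k-1}(v_i-v_{i+1})\times\mathcal T_V^{i-1}\big\rangle$ for $k\ge1$, and the elementary tree $\mathcal T_V=\big\langle(v_D-1)\times\mathcal T_V^{D-1}\oplus\bigoplus_{i=1}^{D-1}(v_i-v_{i+1})\times\mathcal T_V^{i-1}\big\rangle$.
   Formalization: Assumes n ≥ 2 (for n = 1 the quotient (n^{dk_i}-1)/(n^{k_i}-1) is 0/0 and the order is taken modulo 0) and that the sets S_1,…,S_t are pairwise disjoint (a repeated cycle would be counted twice). *)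

(* Defs.v *)
From HB Require Import structures.
From mathcomp Require Import all_boot all_order all_algebra.
Set Implicit Arguments. Unset Strict Implicit. Unset Printing Implicit Defensive.
Import Order.TTheory GRing.Theory Num.Theory.
Local Open Scope ring_scope.
Local Open Scope nat_scope.

(* Moebius function mu(n) (with mu(0) := 0, never used). *)
Definition moebius (n : nat) : int :=
  if (0 < n) && all (fun p => logn p n == 1) (primes n)
  then ((-1) ^+ size (primes n))%R else 0%R.

(* ord_N(b): least e >= 1 with b^e = 1 mod N (searched in 1..N+1, which
   always suffices when gcd(b,N) = 1, N >= 1); 0 if none. *)
Definition ord_mod (N b : nat) : nat :=
  head 0 [seq e <- iota 1 N.+1 | b ^ e == 1 %[mod N]].

Definition great_coprime_div (n v : nat) : nat :=
  \max_(d < v.+1 | (d %| v) && coprime d n) d.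

Definition gcdn_entry (n v i : nat) : nat := gcdn (n ^ i) v %/ gcdn (n ^ i.-1) v.
Definition gcdn_len (n v : nat) : nat :=
  find (fun i => (0 < i) && (gcdn_entry n v i == 1)) (iota 0 v.+2).
Definition gcdn_seq (n v : nat) : seq nat :=
  [seq gcdn_entry n v i | i <- iota 1 (gcdn_len n v)].

Record fgraph := FGraph { fV : finType; fE : fV -> fV }.
Arguments fE : clear implicits.

Definition fg_iso (G1 G2 : fgraph) : Prop :=
  exists phi : fV G1 -> fV G2,
    bijective phi /\ forall x, phi (fE G1 x) = fE G2 (phi x).

(* Subgraph induced on a set C of vertices closed under fE
   (the fallback branch of insubd is never used when C is closed). *)
Definition induced (G : fgraph) (C : {set fV G}) : fgraph :=
  @FGraph {x : fV G | x \in C} (fun x => insubd x (fE G (val x))).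

Definition wconnect (T : finType) (g : T -> T) : rel T :=
  connect (fun a b => (g a == b) || (g b == a)).

Definition fgraph_of (F : finFieldType) (f : {poly F}) : fgraph :=
  @FGraph F (fun a => f.[a]).

Definition G1 (F : finFieldType) (f : {poly F}) : fgraph :=
  @induced (fgraph_of f) [set x : F | ~~ wconnect (fun a : F => f.[a]) x 0%R].

Definition fg_sum (J : finType) (G : J -> fgraph) : fgraph :=
  @FGraph {j : J & fV (G j)}
    (fun x => existT (fun j => fV (G j)) (tag x) (fE (G (tag x)) (tagged x))).

Definition fg_copies (c : nat) (G : fgraph) : fgraph :=
  @FGraph ('I_c * fV G)%type (fun x => (x.1, fE G x.2)).

(* A rooted tree: finite vertex set, parent map (the root is its own
   parent by convention; the edge root -> root is not a tree edge), root. *)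
Record rtree := RTree { tV : finType; tpar : tV -> tV; troot : tV }.
Arguments tpar : clear implicits.
Arguments troot : clear implicits.

Definition bullet : rtree := @RTree unit (fun x => x) tt.

Definition dflt_ct : nat * rtree := (0, bullet).

(* < c_1 x T_1 (+) ... (+) c_s x T_s > for s = [:: (c_1,T_1); ...] *)
Definition node (s : seq (nat * rtree)) : rtree :=
  let VV := fun j : 'I_(size s) =>
      ('I_(nth dflt_ct s j).1 * tV (nth dflt_ct s j).2)%type in
  @RTree (option {j : 'I_(size s) & VV j})
    (fun x => match x with
              | None => None
              | Some (existT j cv) =>
                  if cv.2 == troot (nth dflt_ct s j).2 then None
                  else Some (existT VV j (cv.1, tpar _ cv.2))
              end)
    None.

Definition Cyc (k : nat) (T : rtree) : fgraph :=
  @FGraph ('I_k * tV T)%type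
    (fun x => if x.2 == troot T then (ordS x.1, troot T) else (x.1, tpar T x.2)).

(* Elementary trees.  V = (v_1, ..., v_D), v_i := v_D for i > D. *)
Definition vv (V : seq nat) (i : nat) : nat := nth (last 0 V) V i.-1.

Fixpoint Tlist (V : seq nat) (k : nat) : seq rtree :=
  match k with
  | 0 => [:: bullet]
  | k'.+1 =>
      let L := Tlist V k' in
      rcons L (node ((vv V k'.+1, nth bullet L k')
                     :: [seq (vv V i - vv V i.+1, nth bullet L i.-1)
                        | i <- iota 1 k']))
  end.

Definition Tk (V : seq nat) (k : nat) : rtree := nth bullet (Tlist V k) k.

Definition elem_tree (V : seq nat) : rtree :=
  let D := size V in
  let L := Tlist V D.-1 in
  node ((vv V D - 1, nth bullet L D.-1)
        :: [seq (vv V i - vv V i.+1, nth bullet L i.-1) | i <- iota 1 D.-1]).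

Definition has_form (F : finFieldType) (f : {poly F}) (n : nat) (h : {poly F})
    (m : nat) : Prop :=
  [/\ 0 < m, m %| #|F|.-1, (h.[0] != 0)%R &
      f = ('X^n * (h \Po 'X^(#|F|.-1 %/ m)))%R].

Definition index_rep (F : finFieldType) (f : {poly F}) (n : nat) (h : {poly F})
    (m : nat) : Prop :=
  has_form f n h m /\
  forall n' h' m', has_form f n' h' m' -> m <= m'.

Definition psi (F : finFieldType) (n : nat) (h : {poly F}) (m : nat) (x : F) : F :=
  (x ^+ n * h.[x] ^+ (#|F|.-1 %/ m))%R.

Definition mu (F : finFieldType) (m : nat) : {set F} := [set x : F | (x ^+ m == 1)%R].

Definition m_nice (F : finFieldType) (n : nat) (h : {poly F}) (m : nat) : Prop :=
  (forall x, x \in mu F m -> (psi n h m x != 0)%R -> psi n h m x \in mu F m) /\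
  {in [set x in mu F m | (psi n h m x != 0)%R] &, injective (psi n h m)}.

Definition psi_inf0 (F : finFieldType) (n : nat) (h : {poly F}) (m : nat)
    (x : F) : Prop :=
  x \in mu F m /\ exists i, 0 < i /\ iter i (psi n h m) x = 0%R.

Definition is_cycle_on (T : finType) (g : T -> T) (S : {set T}) (k : nat) : Prop :=
  0 < k /\ #|S| = k /\
  exists2 x0, x0 \in S &
    iter k g x0 = x0 /\ S = [set iter j g x0 | j : 'I_k].

(* Main.v *)
(** Off the component of [0], raising to the power [M = (q-1)/m] maps the graph of [f]
onto the union of the cycles [S_i] of [psi], and each step of [f] multiplies by a constant
after [x |-> x^n] on a coset of the group of [M]-th roots of unity.  Hence every vertex in
the image of [f^i] has the same number [gcd(n^i, M) / gcd(n^(i-1), M)] of preimages in the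
image of [f^(i-1)]; sorting preimages by how deep they lie in these images forces the tree
at every periodic vertex to be the elementary tree.  The cycles are counted by Moebius
inversion from the number of fixed points of [f^(d k_i)] on the fibre over [xi_i], where
[f^(d k_i)] is [x |-> x^(n^(d k_i)) lambda^(1 + n^k_i + ... + n^((d-1) k_i))] with
[lambda = alpha^l_i], so that being fixed is a linear congruence on exponents. *)

(* Tree isomorphisms are not composed: abstract trees are embedded in the field, embeddings are
   glued along children, and only the embedding of the whole target graph is inverted. The
   differences v_i - v_(i+1) arise because the preimages of exact depth j are those counted at depth
   j minus those counted at depth j+1. The modulus of the order comes from the following: with b =
   n^k_i, over xi_i the iterate f^(d k_i) multiplies x by the power of x^(b-1) lambda with exponent
   (b^d - 1)/(b - 1), and on periodic points it is the identity as soon as omega' divides that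
   exponent, that is, as soon as omega' (b - 1) divides b^d - 1. *)
Require Import Defs.
From HB Require Import structures.
From mathcomp Require Import all_boot all_order all_algebra.
From mathcomp Require Import cyclic finfield ring.
Import Order.TTheory GRing.Theory Num.Theory.

Set Implicit Arguments.
Unset Strict Implicit.
Unset Printing Implicit Defensive.

(** * Trees hanging from a vertex of a functional graph *)

Section Hanging.
Variables (X : finType) (f : X -> X) (Q : pred X).
Hypothesis Q_aperiodic : forall z j, Q z -> 0 < j -> iter j f z <> z.

(* [x] lies in the tree below [y]: [Q] cuts the tree off from the cycle carrying its root. *)
Definition desc (y x : X) : Prop :=
  exists j, iter j f x = y /\ forall i, i < j -> Q (iter i f x).

(** An isomorphism of [T] onto the tree below [y], recorded as an injection into [X] so that trees
    at different vertices can be glued inside one set. Nothing is required of [f] at the root, whose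
    parent in [T] is the conventional loop. *)
Definition hangs (y : X) (T : rtree) : Prop :=
  exists e : tV T -> X,
    [/\ injective e, e (troot T) = y,
        forall a, a != troot T -> f (e a) = e (tpar T a) &
        forall x, desc y x <-> exists a, e a = x].

Lemma desc_refl y : desc y y.
Proof. by exists 0. Qed.

Lemma desc_child y z x : f z = y -> Q z -> desc z x -> desc y x.
Proof.
move=> fz Qz [j [jx jQ]]; exists j.+1; split; first by rewrite iterS jx.
by move=> i; rewrite ltnS leq_eqVlt => /orP[/eqP-> | /jQ //]; rewrite jx.
Qed.

Lemma desc_inv y x : desc y x -> x = y \/ exists z, [/\ f z = y, Q z & desc z x].
Proof.
case=> [[|j] [jx jQ]]; first by left.
right; exists (iter j f x); split=> //; first exact: jQ.
by exists j; split=> // i ij; apply: jQ; apply: ltnW.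
Qed.

(** If the orbit of [x] met two distinct children of [y], it would pass from one through [y] to the
    other, which would then return to itself. *)
Lemma desc_child_inj y z z' x :
  f z = y -> f z' = y -> Q z -> Q z' -> desc z x -> desc z' x -> z = z'.
Proof.
have half j j' u u' : f u = y -> f u' = y -> Q u' -> iter j f x = u ->
    iter j' f x = u' -> j <= j' -> u = u'.
  move=> fu fu' Qu' ju ju' /subnK jj'; move: ju'; rewrite -jj' iterD ju.
  case: (j' - j) => [|d]; first by [].
  rewrite iterSr fu -fu' -iterSr => /eqP; case: eqP => // E _.
  by case: (Q_aperiodic Qu' _ E).
move=> fz fz' Qz Qz' [j [jx _]] [j' [jx' _]].
case/orP: (leq_total j j') => le_jj; first exact: half jx jx' le_jj.
by apply/esym; apply: half jx' jx le_jj.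
Qed.

Lemma desc_child_neq y z : f z = y -> Q z -> ~ desc z y.
Proof.
move=> fz Qz [j [jz _]]; apply: (Q_aperiodic (j := j.+1) Qz) => //.
by rewrite iterSr fz.
Qed.

(** The longer of the two paths would run through the end of the shorter one, a point outside
    [Q]. *)
Lemma desc_irr_inj y y' x : ~~ Q y -> ~~ Q y' -> desc y x -> desc y' x -> y = y'.
Proof.
move=> Qy Qy' [j [jx jQ]] [j' [jx' jQ']].
case: (ltngtP j j') => [lt|lt|E]; last by rewrite -jx -jx' E.
  by case/negP: Qy; rewrite -jx jQ'.
by case/negP: Qy'; rewrite -jx' jQ.
Qed.

(* [cls] assigns to each child of [y] the entry of [s] whose tree hangs from it. *)
Lemma hangs_node y (s : seq (nat * rtree)) (cls : X -> nat) :
  (forall z, f z = y -> Q z ->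
     cls z < size s /\ hangs z (nth dflt_ct s (cls z)).2) ->
  (forall j, j < size s ->
     #|[set z | [&& f z == y, Q z & cls z == j]]| = (nth dflt_ct s j).1) ->
  hangs y (node s).
Proof.
move=> hz hcard.
pose A j := [set z | [&& f z == y, Q z & cls z == j]].
have [ee eeP] : exists ee : forall z : X, tV (nth dflt_ct s (cls z)).2 -> X,
  forall z, f z = y -> Q z ->
  [/\ injective (ee z), ee z (troot _) = z,
        forall a, a != troot _ -> f (ee z a) = ee z (tpar _ a) &
        forall x, desc z x <-> exists a, ee z a = x].
  apply: (fin_all_exists (P := fun z ee => f z = y -> Q z ->
    [/\ injective ee, ee (troot _) = z,
        forall a, a != troot _ -> f (ee a) = ee (tpar _ a) &
        forall x, desc z x <-> exists a, ee a = x])) => z.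
  have [/andP[/eqP fz Qz]|nz] := boolP ((f z == y) && Q z).
    by have [_ [e eP]] := hz z fz Qz; exists e.
  exists (fun=> z) => fz Qz; case/negP: nz.
  by rewrite fz eqxx.
(* Copy number [c] of entry [j] is the [c]-th child in that class. The default of [nth] is the value
   itself, as [X] has no distinguished element. *)
have zP (j : 'I_(size s)) (c : 'I_(nth dflt_ct s j).1) :
    exists z : X, z \in A j /\ z = nth z (enum (A j)) c.
  have lt : c < size (enum (A j)) by rewrite -cardE hcard.
  case E: (enum (A j)) lt => [|x0 r] // lt.
  exists (nth x0 (x0 :: r) c); split; first by rewrite -mem_enum E mem_nth.
  exact: set_nth_default.
pose B := {j : 'I_(size s) & 'I_(nth dflt_ct s j).1}.
have [zz zzP] : exists zz : B -> X, forall b, zz b \in A (tag b) /\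
    zz b = nth (zz b) (enum (A (tag b))) (tagged b).
  by apply: (fin_all_exists (P := fun (b : B) z => z \in A (tag b) /\
    z = nth z (enum (A (tag b))) (tagged b))) => b; apply: zP.
have zzA b : [/\ f (zz b) = y, Q (zz b) & cls (zz b) = tag b].
  by case: (zzP b) => + _; rewrite inE => /and3P[/eqP-> -> /eqP->].
have zz_inj : injective zz.
  move=> [j c] [j' c'] E; have [_ _ /= cj] := zzA (Tagged _ c).
  have [_ _ /= cj'] := zzA (Tagged _ c').
  have Ej : j = j' by apply: val_inj; rewrite /= -cj -cj' E.
  case: _ / Ej => {j'} in c' {cj'} E *; congr existT; apply: val_inj => /=.
  have [zA] := zzP (Tagged _ c); have [_] := zzP (Tagged _ c').
  rewrite /= -E => E1 E2; move: E1; rewrite E2 /=.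
  set z := (zz _); move/eqP; rewrite -E2.
  move=> /eqP E1; apply/eqP; rewrite -(nth_uniq z _ _ (enum_uniq (A j))).
  - by rewrite -E2 -E1.
  - by rewrite -cardE hcard.
  - by rewrite -cardE hcard.
have zz_surj z : f z = y -> Q z -> exists b, zz b = z.
  move=> fz Qz; have [lt _] := hz z fz Qz; pose j := Ordinal lt.
  have zA : z \in A j by rewrite inE fz Qz !eqxx.
  have ltc : index z (enum (A j)) < (nth dflt_ct s j).1.
    by rewrite -hcard // cardE index_mem mem_enum.
  exists (existT _ j (Ordinal ltc)).
  have [_ ->] := zzP (existT _ j (Ordinal ltc)).
  by rewrite /= nth_index // mem_enum.
have zzC b : cls (zz b) = tag b by case: (zzA b).
pose cast (b : B) (a : tV (nth dflt_ct s (tag b)).2) :=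
  ecast i (tV (nth dflt_ct s i).2) (esym (zzC b)) a.
pose eb (b : B) a := ee (zz b) (cast b a).
have ebP b : [/\ injective (eb b), eb b (troot _) = zz b,
        forall a, a != troot _ -> f (eb b a) = eb b (tpar _ a) &
        forall x, desc (zz b) x <-> exists a, eb b a = x].
  rewrite /eb /cast; case: (zzA b) => fz Qz _; have := eeP _ fz Qz.
  move: (ee (zz b)) (esym (zzC b)); move: (cls _) => c e E.
  by case: _ / E e.
pose VV := fun j : 'I_(size s) =>
      ('I_(nth dflt_ct s j).1 * tV (nth dflt_ct s j).2)%type.
pose e : tV (node s) -> X := fun v => match v with
  | None => y
  | Some (existT j ca) => eb (existT _ j ca.1) ca.2
  end.
have ebD j c a : desc (zz (existT _ j c)) (eb (existT _ j c) a).
  by have [_ _ _ D] := ebP (existT _ j c); apply/D; exists a.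
exists e; split=> //.
- move=> [[j [c a]]|] [[j' [c' a']]|] //= E.
  + have [fz Qz _] := zzA (existT _ j c).
    have [fz' Qz' _] := zzA (existT _ j' c').
    have D := ebD j c a.
    have D' := ebD j' c' a'.
    rewrite -E in D'; have := desc_child_inj fz fz' Qz Qz' D D'.
    move/zz_inj/eqP; rewrite -tag_eqE /tag_eq /= => /andP[/eqP Ej].
    case: _ / Ej => {j'} in c' a' {D' fz' Qz'} E *.
    rewrite tagged_asE => /eqP Ec; rewrite -Ec in E *.
    by have [inj _ _ _] := ebP (existT _ j c); rewrite (inj _ _ E).
  + have [fz Qz _] := zzA (existT _ j c).
    by have D := ebD j c a; rewrite E in D; case: (desc_child_neq fz Qz D).
  + have [fz Qz _] := zzA (existT _ j' c').
    by have D := ebD j' c' a'; rewrite -E in D; case: (desc_child_neq fz Qz D).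
- move=> [[j [c a]]|] //= _; have [_ R P _] := ebP (existT _ j c).
  have [fz Qz _] := zzA (existT _ j c).
  by case: ifPn => [/eqP->|/P //]; rewrite R.
- move=> x; split.
    case/desc_inv=> [->|[z [fz Qz dz]]]; first by exists None.
    have [[j c] Ez] := zz_surj z fz Qz; rewrite -Ez in dz.
    have [_ _ _ D] := ebP (existT _ j c); have [a Ea] := (D x).1 dz.
    by exists (Some (existT VV j (c, a))).
case=> [[[j [c a]]|]] <- /=; last exact: desc_refl.
have [fz Qz _] := zzA (existT _ j c).
exact: desc_child fz Qz (ebD j c a).
Qed.

End Hanging.

(** * Elementary trees from fibre counts *)

Lemma size_Tlist V k : size (Tlist V k) = k.+1.
Proof. by elim: k => //= k IH; rewrite size_rcons IH. Qed.

Lemma nth_Tlist V k j : j <= k -> nth bullet (Tlist V k) j = Tk V j.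
Proof.
elim: k => [|k IH]; first by rewrite leqn0 => /eqP->.
rewrite leq_eqVlt => /orP[/eqP-> //|jk].
by rewrite /= nth_rcons size_Tlist jk IH.
Qed.

Lemma TkS V k : Tk V k.+1 =
  node ((vv V k.+1, Tk V k) ::
        [seq (vv V i - vv V i.+1, Tk V i.-1) | i <- iota 1 k]).
Proof.
rewrite /Tk /= nth_rcons size_Tlist ltnn eqxx; congr (node (_ :: _)).
apply/eq_in_map => i; rewrite mem_iota add1n => /andP[i0 ik].
by rewrite nth_Tlist // -ltnS prednK // ltnW.
Qed.

Lemma elem_treeE V : elem_tree V =
  node ((vv V (size V) - 1, Tk V (size V).-1) ::
        [seq (vv V i - vv V i.+1, Tk V i.-1) | i <- iota 1 (size V).-1]).
Proof.
rewrite /elem_tree nth_Tlist //; congr (node (_ :: _)).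
apply/eq_in_map => i; rewrite mem_iota add1n => /andP[i0 ik].
by rewrite nth_Tlist // -ltnS prednK // ltnW.
Qed.

Section Levels.
Variables (X : finType) (f : X -> X) (C : {set X}) (V : seq nat).
Hypothesis C_stable : forall x, (f x \in C) = (x \in C).

Definition depth_set i : {set X} := [set iter i f x | x in C].

Hypothesis V_pos : 0 < size V.
Hypothesis V_last : vv V (size V) = 1.
Hypothesis card_fiber : forall i y, y \in depth_set i.+1 ->
  #|[set z in depth_set i | f z == y]| = vv V i.+1.

(* Injectivity of [f] here (the last fibre count is 1) makes these the periodic points. *)
Definition core : {set X} := depth_set (size V).-1.
Definition transient : pred X := [pred z | (z \in C) && (z \notin core)].
(** For transient [z], the largest [j] with [z] in [depth_set j], that is, the height of the tree
    below [z]; the first failure decides because the sets are nested. *)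
Definition level (z : X) : nat :=
  find (fun j => z \notin depth_set j.+1) (iota 0 (size V).-1).

Lemma iter_stable i x : (iter i f x \in C) = (x \in C).
Proof. by elim: i => //= i <-. Qed.

Lemma depth_setP i y :
  reflect (exists2 x, x \in C & y = iter i f x) (y \in depth_set i).
Proof. exact: imsetP. Qed.

Lemma depth_set0 : depth_set 0 = C.
Proof. by rewrite /depth_set imset_id. Qed.

Lemma depth_set_step i z : z \in depth_set i -> f z \in depth_set i.+1.
Proof. by case/depth_setP => x xC ->; apply/depth_setP; exists x. Qed.

Lemma depth_set_anti i j : i <= j -> {subset depth_set j <= depth_set i}.
Proof.
move=> ij y /depth_setP[x xC ->]; apply/depth_setP.
by exists (iter (j - i) f x); rewrite ?iter_stable // -iterD subnKC.
Qed.

Lemma depth_set_sub i : {subset depth_set i <= C}.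
Proof. by rewrite -depth_set0; apply: depth_set_anti. Qed.

Lemma core_sub : {subset core <= C}.
Proof. exact: depth_set_sub. Qed.

Lemma core_stable : {homo f : y / y \in core}.
Proof. by move=> y /depth_set_step; apply: depth_set_anti. Qed.

Lemma core_inj : {in core &, injective f}.
Proof.
move=> z z' zP z'P E.
have fzI : f z \in depth_set (size V).-1.+1 by exact: depth_set_step.
have := card_fiber fzI; rewrite prednK // V_last => /eqP/cards1P[w Ew].
have : z \in [set w] by rewrite -Ew inE eqxx andbT.
have : z' \in [set w] by rewrite -Ew inE -E eqxx andbT.
by rewrite !inE => /eqP-> /eqP->.
Qed.

(** Going [i] times round the loop exhibits [z] as its own image after [i * j] steps. *)
Lemma periodic_depth z j i : z \in C -> 0 < j -> iter j f z = z -> z \in depth_set i.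
Proof.
move=> zC j0 jz; have zz : iter (i * j) f z = z.
  by elim: i => //= i IH; rewrite mulSn iterD IH.
apply: (@depth_set_anti _ (i * j)); first by rewrite leq_pmulr.
by apply/depth_setP; exists z.
Qed.

Lemma periodic_core z j : z \in C -> 0 < j -> iter j f z = z -> z \in core.
Proof. exact: periodic_depth. Qed.

Lemma core_periodic y : y \in core -> iter (order f y) f y = y.
Proof.
move=> yP; apply: (iter_order_in (S := core)) => //; first exact: core_stable.
exact: core_inj.
Qed.

Lemma transient_aperiodic z j : transient z -> 0 < j -> iter j f z <> z.
Proof. by case/andP=> zC /negP zP j0 jz; apply/zP/(periodic_core zC j0 jz). Qed.

Lemma core_depth y i : y \in core -> y \in depth_set i.
Proof.
move=> yP; apply: periodic_depth (core_periodic yP); last exact: order_gt0.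
exact: core_sub.
Qed.

Lemma levelP z : transient z ->
  [/\ z \in depth_set (level z), z \notin depth_set (level z).+1 &
      level z < (size V).-1].
Proof.
case/andP=> zC zP; have hz : has (fun j => z \notin depth_set j.+1) (iota 0 (size V).-1).
  apply/hasP; case E: (size V).-1 => [|d].
    by move: zP; rewrite /core E depth_set0 zC.
  by exists d; rewrite ?mem_iota ?ltnSn // -E.
have lt : level z < (size V).-1 by rewrite /level -[X in _ < X](size_iota 0) -has_find.
have := nth_find 0 hz; rewrite -/(level z) nth_iota // add0n => nz; split=> //.
case E: (level z) => [|j]; first by rewrite depth_set0.
have jl : j < find (fun j => z \notin depth_set j.+1) (iota 0 (size V).-1).
  by rewrite -/(level z) E.
have /negbFE := before_find 0 jl; rewrite nth_iota ?add0n //.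
by rewrite (ltn_trans _ lt) // E.
Qed.

Lemma levelE z j : z \in C -> j < (size V).-1 ->
  transient z && (level z == j) = (z \in depth_set j) && (z \notin depth_set j.+1).
Proof.
move=> zC jD; apply/andP/andP => [[tz /eqP<-]|[zj zj']].
  by have [-> ->] := levelP tz.
have tz : transient z.
  rewrite /transient /= zC /=; apply: contra zj'; exact: depth_set_anti.
split=> //; have [zl zl' _] := levelP tz; rewrite eqn_leq; apply/andP; split.
  rewrite leqNgt; apply: contra zj' => lt; exact: depth_set_anti zl.
rewrite leqNgt; apply: contra zl' => lt; exact: depth_set_anti zj.
Qed.

Lemma card_level_inner y j : y \in depth_set j.+2 -> j < (size V).-1 ->
  #|[set z | [&& f z == y, transient z & level z == j]]| = vv V j.+1 - vv V j.+2.
Proof.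
move=> yj jD; have yC := depth_set_sub yj.
rewrite -(card_fiber (depth_set_anti (leqnSn _) yj)) -(card_fiber yj).
rewrite -cardsDS; last first.
  apply/subsetP => z; rewrite !inE => /andP[zj ->]; rewrite andbT.
  exact: depth_set_anti zj.
apply: eq_card => z; rewrite !inE; case: eqP => [fz|] /=; last by rewrite !andbF.
have zC : z \in C by rewrite -C_stable fz.
by rewrite levelE // !andbT andbC.
Qed.

(** No preimage of [y] lies in [depth_set j.+1], so nothing is subtracted; this produces the leading
    coefficient v_k of T^k. *)
Lemma card_level_top y j : y \in depth_set j.+1 -> y \notin depth_set j.+2 ->
    j < (size V).-1 ->
  #|[set z | [&& f z == y, transient z & level z == j]]| = vv V j.+1.
Proof.
move=> yj yj' jD; have yC := depth_set_sub yj.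
rewrite -(card_fiber yj).
apply: eq_card => z; rewrite !inE; case: eqP => [fz|] /=; last by rewrite !andbF.
have zC : z \in C by rewrite -C_stable fz.
rewrite levelE // andbT; case: (z \in depth_set j) => //=.
by apply: contra yj' => zj; rewrite -fz depth_set_step.
Qed.

(** Strong induction, because the children of a vertex of level [k] may have any level below [k]. *)
Lemma hangs_Tk k y : y \in depth_set k -> y \notin depth_set k.+1 ->
  k < (size V).-1 -> hangs f transient y (Tk V k).
Proof.
have [K le_kK] := ubnP k; elim: K k le_kK y => // K IH [|k] le_kK y yk yk' kD.
  exists (fun=> y); split=> //=; try by case=> // -[].
  move=> x; split=> [/desc_inv[->|[z [fz tz _]]]|[_ <-]]; first by exists tt.
    case/negP: yk'; rewrite -fz depth_set_step // depth_set0.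
    by case/andP: tz.
  exact: desc_refl.
rewrite TkS; set s := _ :: _.
have size_s : size s = k.+1 by rewrite /= size_map size_iota.
have nths i : i < k -> nth dflt_ct s i.+1 = (vv V i.+1 - vv V i.+2, Tk V i).
  by move=> ik; rewrite /= (nth_map 0) ?size_iota // nth_iota.
have lev_le z : f z = y -> transient z -> level z <= k.
  move=> fz tz; have [zl _ _] := levelP tz; rewrite leqNgt.
  apply: contra yk' => lt; rewrite -fz depth_set_step //.
  exact: depth_set_anti zl.
(* The list defining T^(k+1) starts with the children of top level [k]; those of a lower level [j]
   sit at index [j.+1]. *)
apply: (hangs_node transient_aperiodic
          (cls := fun z => if level z == k then 0 else (level z).+1)).
  move=> z fz tz; have lk := lev_le z fz tz; have [zl zl' lD] := levelP tz.
  have Hz : hangs f transient z (Tk V (level z)).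
    by apply: IH => //; apply: leq_ltn_trans lk _.
  case: ifPn => [/eqP E|nE]; first by split=> //=; rewrite -E.
  have lk' : level z < k by rewrite ltn_neqAle nE.
  by rewrite nths // size_s ltnS.
case=> [|j] jk.
  rewrite -[RHS](card_level_top yk yk'); last exact: ltnW.
  by apply: eq_card => z; rewrite !inE; case: (level z == k).
rewrite size_s ltnS in jk; rewrite nths //.
have jD : j < (size V).-1 by apply: leq_trans kD; rewrite (leq_trans jk) // leqW.
have yj : y \in depth_set j.+2 by apply: depth_set_anti yk.
rewrite -(card_level_inner yj jD).
apply: eq_card => z; rewrite !inE; case: (level z =P k) => [->|_]; last by rewrite eqSS.
by rewrite (gtn_eqF jk).
Qed.

(** A periodic vertex lies in every [depth_set], so each level contributes a difference. The leading
    entry has multiplicity v_D - 1 = 0, the one preimage in the core being the predecessor on the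
    cycle; classes therefore start at index 1. *)
Lemma hangs_elem_tree y : y \in core -> hangs f transient y (elem_tree V).
Proof.
move=> yP; rewrite elem_treeE; set s := _ :: _.
have size_s : size s = size V by rewrite /= size_map size_iota prednK.
have nths i : i < (size V).-1 -> nth dflt_ct s i.+1 = (vv V i.+1 - vv V i.+2, Tk V i).
  by move=> ik; rewrite /= (nth_map 0) ?size_iota // nth_iota.
apply: (hangs_node transient_aperiodic (cls := fun z => (level z).+1)).
  move=> z fz tz; have [zl zl' lD] := levelP tz; rewrite nths //.
  by rewrite size_s -[size V]prednK // ltnS lD; split=> //; apply: hangs_Tk.
case=> [|j] jD.
  by rewrite /= V_last; apply: eq_card0 => z; rewrite !inE !andbF.
rewrite size_s -[size V]prednK // ltnS in jD; rewrite nths //.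
rewrite -(card_level_inner (core_depth _ yP) jD).
by apply: eq_card => z; rewrite !inE eqSS.
Qed.

Lemma core_desc x : x \in C -> exists2 y, y \in core & desc f transient y x.
Proof.
move=> xC; have ex : exists j, iter j f x \in core.
  by exists (size V).-1; apply/depth_setP; exists x.
case: (ex_minnP ex) => j jP jmin; exists (iter j f x) => //; exists j; split=> //.
move=> i ij; rewrite /transient /= iter_stable xC /=.
by apply: contraL ij => /jmin; rewrite -leqNgt.
Qed.

End Levels.

(** * Assembling cycles with trees *)

(** A map out of [H] can be written by matching on its explicit vertices; the map that [fg_iso] asks
    for goes the other way and is obtained by choice. *)
Lemma fg_iso_induced (G H : Defs.fgraph) (C : {set fV G}) (E : fV H -> fV G) :
  injective E -> (forall v, fE G (E v) = E (fE H v)) ->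
  (forall v, E v \in C) -> (forall x, x \in C -> exists v, E v = x) ->
  fg_iso (induced C) H.
Proof.
move=> E_inj E_mor E_in E_surj.
have [phi phiP] : exists phi : fV (induced C) -> fV H, forall x, E (phi x) = val x.
  apply: (fin_all_exists (P := fun (x : fV (induced C)) v => E v = val x)) => x.
  exact/E_surj/(valP x).
exists phi; split.
  exists (fun v => exist _ (E v) (E_in v) : fV (induced C)).
    by move=> x; apply: val_inj; rewrite /= phiP.
  by move=> v; apply: E_inj; rewrite phiP.
move=> x; apply: E_inj; rewrite phiP -E_mor phiP /= val_insubd.
by rewrite -phiP E_mor E_in.
Qed.

Section Assembly.
Variables (X : finType) (f : X -> X) (C : {set X}) (V : seq nat).
Hypothesis C_stable : forall x, (f x \in C) = (x \in C).
Hypothesis V_pos : 0 < size V.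
Hypothesis V_last : vv V (size V) = 1.
Hypothesis card_fiber : forall i y, y \in depth_set f C i.+1 ->
  #|[set z in depth_set f C i | f z == y]| = vv V i.+1.
Variables (J : finType) (c len : J -> nat) (base : forall j, 'I_(c j) -> X).
Let K := core f C V.
Hypothesis base_core : forall j b, @base j b \in K.
Hypothesis base_cycle : forall j b, iter (len j) f (@base j b) = base b.
Hypothesis base_inj : forall j (b : 'I_(c j)) a j' (b' : 'I_(c j')) a',
  a < len j -> a' < len j' -> iter a f (base b) = iter a' f (base b') ->
  existT (fun j => 'I_(c j)) j b = existT (fun j => 'I_(c j)) j' b' /\ a = a'.
Hypothesis base_surj : forall y, y \in K ->
  exists j, exists b : 'I_(c j), exists2 a, a < len j & iter a f (base b) = y.

(** The vertex (j, b, a, x) goes to the vertex [x] of the tree below the [a]-th iterate of [base b].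
    Distinct core vertices have disjoint trees, and every element of [C] lies in one of them. *)
Lemma fg_iso_cycles :
  fg_iso (@induced (FGraph f) C)
    (fg_sum (fun j => fg_copies (c j) (Cyc (len j) (elem_tree V)))).
Proof.
set T := elem_tree V; pose Q := transient f C V.
have Q_aper := @transient_aperiodic _ f C V C_stable.
have [e eP] : exists e : X -> tV T -> X, forall y, y \in K ->
    [/\ injective (e y), e y (troot T) = y,
        forall a, a != troot T -> f (e y a) = e y (tpar T a) &
        forall x, desc f Q y x <-> exists a, e y a = x].
  apply: (fin_all_exists (P := fun y (e : tV T -> X) => y \in K ->
    [/\ injective e, e (troot T) = y,
        forall a, a != troot T -> f (e a) = e (tpar T a) &
        forall x, desc f Q y x <-> exists a, e a = x])) => y.
  have [yK|nK] := boolP (y \in K); last by exists (fun=> y).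
  have [e eP] := hangs_elem_tree C_stable V_pos V_last card_fiber yK.
  by exists e.
have nQ y : y \in K -> ~~ Q y by move=> yK; rewrite /Q /transient /= -/K yK andbF.
have K_iter y a : y \in K -> iter a f y \in K.
  by move=> yK; elim: a => //= a; apply: core_stable.
pose H := fg_sum (fun j => fg_copies (c j) (Cyc (len j) T)).
pose E (v : fV H) : X :=
  let: existT j (b, (a, x)) := v in e (iter a f (base b)) x.
apply: (@fg_iso_induced (FGraph f) H C E).
- move=> [j [b [a x]]] [j' [b' [a' x']]] /= Ev.
  have yK := K_iter _ a (base_core b); have yK' := K_iter _ a' (base_core b').
  have [inj _ _ D] := eP _ yK; have [_ _ _ D'] := eP _ yK'.
  have Ey : iter a f (base b) = iter a' f (base b').
    apply: (desc_irr_inj (nQ _ yK) (nQ _ yK')); first by apply/D; exists x.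
    by apply/D'; exists x'.
  rewrite -Ey in Ev; have {Ev inj} -> := inj _ _ Ev.
  have [Eb Ea] := base_inj (ltn_ord a) (ltn_ord a') Ey.
  move/eqP: Eb; rewrite -tag_eqE /tag_eq /= => /andP[/eqP Ej].
  case: _ / Ej => {j'} in b' a' {yK' D'} Ey Ea *.
  by rewrite tagged_asE => /eqP ->; rewrite (ord_inj Ea).
- move=> [j [b [a x]]] /=; have yK := K_iter _ a (base_core b).
  have [_ R P _] := eP _ yK.
  have [->|nx] /= := eqVneq x (troot T); last by rewrite P.
  rewrite R; have yK1 := K_iter _ a.+1 (base_core b).
  rewrite /tag /=; have Ea : iter (a.+1 %% len j) f (base b) = f (iter a f (base b)).
    have := ltn_ord a; rewrite leq_eqVlt => /orP[/eqP Ea|lt].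
      by rewrite -iterS Ea modnn base_cycle.
    by rewrite modn_small.
  by rewrite Ea; have [_ -> _ _] := eP _ yK1.
- move=> [j [b [a x]]] /=; have yK := K_iter _ a (base_core b).
  have [_ _ _ D] := eP _ yK.
  have [i [Ei _]] : desc f Q (iter a f (base b)) (e (iter a f (base b)) x).
    by apply/D; exists x.
  by rewrite -(iter_stable C_stable i) Ei; apply: (core_sub C_stable yK).
move=> x xC; have [y yK yx] := core_desc V C_stable xC.
have [_ _ _ D] := eP _ yK; have [w Ew] := (D x).1 yx.
have [j [b [a ja Ey]]] := base_surj yK.
exists (existT _ j (b, (Ordinal ja, w))).
by rewrite /E /= Ey.
Qed.

End Assembly.

(** * Moebius inversion and gcd sequences *)

Lemma moebius_mul_prime p d : prime p -> 0 < d -> ~~ (p %| d) ->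
  moebius (p * d) = (- moebius d)%R.
Proof.
move=> pp d0 npd.
have npr : p \notin primes d by rewrite mem_primes pp d0.
have perm : perm_eq (primes (p * d)) (p :: primes d).
  apply: uniq_perm; rewrite ?primes_uniq //= ?npr ?primes_uniq //.
  by move=> x; rewrite primesM // ?prime_gt0 // (primes_prime pp) !inE.
rewrite /moebius muln_gt0 prime_gt0 // d0 /= (perm_size perm) (perm_all _ perm) /=.
have -> : logn p (p * d) == 1.
  by rewrite lognM // ?prime_gt0 // logn_prime // eqxx lognE pp d0 (negPf npd).
have -> : all (fun q => logn q (p * d) == 1) (primes d) =
          all (fun q => logn q d == 1) (primes d).
  apply: eq_in_all => q qd; rewrite lognM // ?prime_gt0 // logn_prime //.
  by case: (q =P p) qd => // ->; rewrite (negPf npr).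
by rewrite /=; case: ifP => _; rewrite ?oppr0 // exprS mulN1r.
Qed.

Lemma moebius_sqr p d : prime p -> p ^ 2 %| d -> moebius d = 0%R.
Proof.
move=> pp pd; rewrite /moebius; case: ltnP => //= d0.
case: ifP => // /allP/(_ p); rewrite mem_primes pp d0 /=.
rewrite (dvdn_trans _ pd) ?dvdn_exp // => /(_ isT) /eqP E.
by move: pd; rewrite pfactor_dvdn // E.
Qed.

(** For n > 1 with least prime factor p, divisors divisible by p^2 contribute 0 and the others
    cancel in pairs d, p d. *)
Lemma sum_moebius n : 0 < n -> (\sum_(d <- divisors n) moebius d = (n == 1)%:R)%R.
Proof.
move=> n0; case: eqP => [->|/eqP n1]; first by rewrite /= big_seq1.
have n_gt1 : 1 < n by rewrite ltn_neqAle eq_sym n1.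
pose p := pdiv n; have pp : prime p by exact: pdiv_prime.
have p0 := prime_gt0 pp.
rewrite (bigID (fun d => p %| d)) /= (bigID (fun d => p ^ 2 %| d)) /=.
rewrite big1 ?add0r; last by move=> d /andP[_ /(moebius_sqr pp)].
rewrite -big_filter -[X in (_ + X)%R]big_filter.
rewrite (perm_big [seq p * d | d <- divisors n & ~~ (p %| d)]) /=; last first.
  apply: uniq_perm; rewrite ?filter_uniq ?divisors_uniq //.
    rewrite map_inj_uniq ?filter_uniq ?divisors_uniq // => x y /eqP.
    by rewrite eqn_pmul2l // => /eqP.
  move=> x; rewrite mem_filter -dvdn_divisors //.
  apply/andP/mapP => [[/andP[px npx] xn]|[d +]].
    exists (x %/ p); last by rewrite mulnC divnK.
    rewrite mem_filter -dvdn_divisors // (dvdn_trans _ xn) ?dvdn_div //.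
    rewrite andbT; apply: contra npx => ppx.
    by rewrite -(divnK px) -mulnn dvdn_mul.
  rewrite mem_filter -dvdn_divisors // => /andP[npd dn] ->.
  rewrite dvdn_mulr //= -mulnn dvdn_pmul2l // npd; split=> //.
  by rewrite Gauss_dvd ?prime_coprime // pdiv_dvd.
rewrite big_map -big_split /= big_seq big1 // => d.
rewrite mem_filter -dvdn_divisors // => /andP[npd dn].
by rewrite moebius_mul_prime ?addNr // (dvdn_gt0 n0 dn).
Qed.

(** After exchanging the sums, the coefficient of [E e] is the sum of mu(u/d) over e | d | u, which
    d -> u/d turns into the sum of mu over the divisors of u/e. *)
Lemma moebius_inversion (E : nat -> int) u : 0 < u ->
  (\sum_(d <- divisors u) moebius (u %/ d) * (\sum_(e <- divisors d) E e) = E u)%R.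
Proof.
move=> u0.
transitivity (\sum_(e <- divisors u) \sum_(d <- divisors u | (e %| d)%N)
                moebius (u %/ d) * E e)%R.
  rewrite [RHS](exchange_big_dep predT) //= [LHS]big_seq [RHS]big_seq.
  apply: eq_bigr => d; rewrite -dvdn_divisors // => du.
  have d0 := dvdn_gt0 u0 du.
  rewrite big_distrr /= -[RHS]big_filter; apply: perm_big; apply: uniq_perm.
  - exact: divisors_uniq.
  - by rewrite filter_uniq // divisors_uniq.
  move=> e; rewrite mem_filter -!dvdn_divisors //.
  by apply/idP/andP => [ed|[]//]; split=> //; apply: dvdn_trans ed du.
rewrite [LHS](bigD1_seq u) ?divisors_uniq -?dvdn_divisors //= [X in (_ + X)%R]big_seq_cond.
have inner e : e %| u ->
    (\sum_(d <- divisors u | (e %| d)%N) moebius (u %/ d) * E e = (u == e)%:R * E e)%R.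
  move=> eu; have e0 := dvdn_gt0 u0 eu; rewrite -big_distrl /=; congr (_ * _)%R.
  have -> : (u == e) = (u %/ e == 1).
    by rewrite -[in RHS](eqn_pmul2r e0) divnK // mul1n.
  rewrite -sum_moebius ?divn_gt0 ?(dvdn_leq u0) // -big_filter.
  rewrite -(big_map (fun d => u %/ d) predT moebius); apply: perm_big.
  have ud d : d %| u -> u %/ (u %/ d) = d.
    by move=> du; rewrite divnA // mulKn.
  apply: uniq_perm; rewrite ?divisors_uniq //.
    rewrite map_inj_in_uniq ?filter_uniq ?divisors_uniq // => x y.
    rewrite !mem_filter -!dvdn_divisors // => /andP[_ xu] /andP[_ yu] Exy.
    by rewrite -(ud x) // Exy ud.
  have ue0 : 0 < u %/ e by rewrite divn_gt0 ?(dvdn_leq u0).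
  move=> x; rewrite -dvdn_divisors //; apply/mapP/idP => [[d]|xue].
    rewrite mem_filter -dvdn_divisors // => /andP[ed du] ->.
    by rewrite dvdn_divRL // -[X in _ %| X](divnK du) dvdn_mul.
  have xu : x %| u by apply: dvdn_trans xue (dvdn_div eu).
  exists (u %/ x); last by rewrite ud.
  rewrite mem_filter -dvdn_divisors // dvdn_div // andbT.
  by move: xue; rewrite !dvdn_divRL // mulnC.
rewrite [X in (_ + X)%R]big1 => [|e /andP[]]; first by rewrite inner // eqxx mul1r addr0.
rewrite -dvdn_divisors // => eu neu; rewrite inner // eq_sym (negPf neu).
by rewrite mul0r.
Qed.

Section GcdSeq.
Variables (n v : nat).
Hypotheses (n_gt1 : 1 < n) (v_gt0 : 0 < v).

(** Each gcd is a function of the previous one, so the sequence is constant from its first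
    repetition on. *)
Lemma gcdn_expS i : gcdn (n ^ i.+1) v = gcdn (n * gcdn (n ^ i) v) v.
Proof.
by rewrite muln_gcdr -expnS -gcdnA (_ : gcdn (n * v) v = v) //;
  apply/gcdn_idPr; rewrite dvdn_mull.
Qed.

Lemma gcdn_entry_gt0 i : 0 < gcdn_entry n v i.+1.
Proof.
rewrite /gcdn_entry divn_gt0 ?gcdn_gt0 ?v_gt0 ?orbT //.
by apply: dvdn_leq; rewrite ?gcdn_gt0 ?v_gt0 ?orbT // dvdn_gcd dvdn_gcdr
  (dvdn_trans (dvdn_gcdl _ _)) // dvdn_exp2l.
Qed.

Lemma gcdn_entryM i : gcdn_entry n v i.+1 * gcdn (n ^ i) v = gcdn (n ^ i.+1) v.
Proof.
rewrite /gcdn_entry divnK //.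
by rewrite dvdn_gcd dvdn_gcdr (dvdn_trans (dvdn_gcdl _ _)) // dvdn_exp2l.
Qed.

Lemma gcdn_entry_stable i j : gcdn_entry n v i.+1 = 1 -> i <= j -> gcdn_entry n v j.+1 = 1.
Proof.
move=> Ei; elim: j => [|j IH]; first by case: i Ei.
rewrite leq_eqVlt => /orP[/eqP<- //|ij]; have := gcdn_entryM j.
rewrite IH // mul1n => Ej; apply/eqP.
rewrite -(eqn_pmul2r (m := gcdn (n ^ j.+1) v)) ?gcdn_gt0 ?v_gt0 ?orbT //.
by rewrite gcdn_entryM mul1n gcdn_expS -Ej -gcdn_expS Ej.
Qed.

(** If no entry were 1, each step would at least double gcd(n^i, v), which would exceed [v] after
    [v.+1] steps. *)
Lemma has_gcdn_len : has (fun i => (0 < i) && (gcdn_entry n v i == 1)) (iota 0 v.+2).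
Proof.
apply: contraT => /hasPn no1.
have grow i : i <= v.+1 -> 2 ^ i <= gcdn (n ^ i) v.
  elim: i => [|i IH] iv; first by rewrite gcdn_gt0 v_gt0 orbT.
  rewrite -gcdn_entryM expnS leq_mul //; last by rewrite IH // ltnW.
  rewrite ltn_neqAle gcdn_entry_gt0 eq_sym andbT.
  by apply: (no1 i.+1); rewrite mem_iota.
have := leq_trans (grow _ (leqnn _)) (dvdn_leq v_gt0 (dvdn_gcdr _ _)).
rewrite leqNgt; case/negP; apply: (leq_trans (ltn_expl v (ltnSn 1))).
by rewrite leq_exp2l.
Qed.

Lemma gcdn_len_gt0 : 0 < gcdn_len n v.
Proof.
have := nth_find 0 has_gcdn_len; rewrite nth_iota; first by case/andP.
by have := has_gcdn_len; rewrite has_find size_iota.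
Qed.

Lemma gcdn_entry_len : gcdn_entry n v (gcdn_len n v) = 1.
Proof.
have := nth_find 0 has_gcdn_len; rewrite nth_iota; first by case/andP=> _ /eqP.
by have := has_gcdn_len; rewrite has_find size_iota.
Qed.

Lemma size_gcdn_seq : size (gcdn_seq n v) = gcdn_len n v.
Proof. by rewrite size_map size_iota. Qed.

(** Past the end of the list [vv] repeats the last entry, which is 1, in agreement with the
    stabilised quotients. *)
Lemma vv_gcdn_seq i : vv (gcdn_seq n v) i.+1 = gcdn_entry n v i.+1.
Proof.
have D0 := gcdn_len_gt0; rewrite /vv [i.+1.-1]/=.
have [iD|Di] := ltnP i (gcdn_len n v).
  by rewrite (nth_map 0) ?size_iota // nth_iota.
rewrite nth_default ?size_gcdn_seq // -nth_last size_gcdn_seq /gcdn_seq.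
rewrite (nth_map 0) ?size_iota ?prednK // nth_iota ?prednK // add1n prednK //.
rewrite gcdn_entry_len (@gcdn_entry_stable (gcdn_len n v).-1) ?prednK ?gcdn_entry_len //.
exact: leq_trans (leq_pred _) Di.
Qed.

Lemma vv_gcdn_seq_last : vv (gcdn_seq n v) (size (gcdn_seq n v)) = 1.
Proof.
rewrite size_gcdn_seq -(prednK gcdn_len_gt0) vv_gcdn_seq prednK ?gcdn_len_gt0 //.
exact: gcdn_entry_len.
Qed.

End GcdSeq.

(** * The largest divisor coprime to n, and its cofactor *)

Section CoprimePart.
Variables (n v : nat).
Hypothesis v_gt0 : 0 < v.
Let g := great_coprime_div n v.

Lemma great_coprime_div_max d : d %| v -> coprime d n -> d <= g.
Proof.
move=> dv dn; have lt : d < v.+1 by rewrite ltnS dvdn_leq.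
rewrite -[d]/(val (Ordinal lt)).
by apply: (@leq_bigmax_cond _ [pred d : 'I_v.+1 | (d %| v) && coprime d n]
  (fun d => val d)); rewrite inE /= dv.
Qed.

Lemma great_coprime_divP : (g %| v) /\ coprime g n.
Proof.
have lt1 : 1 < v.+1 by [].
have := @eq_bigmax_cond _ [pred d : 'I_v.+1 | (d %| v) && coprime d n] (fun d => val d).
case; first by apply/card_gt0P; exists (Ordinal lt1); rewrite inE /= dvd1n coprime1n.
by move=> d; rewrite inE => /andP[dv dn] E; rewrite /g /great_coprime_div E.
Qed.

(** A prime factor of [v %/ g] not dividing [n] could be multiplied into [g], against maximality.
    The exponent [v %/ g] exceeds all of its own valuations. *)
Lemma great_coprime_div_cofactor : exists s, v %/ g %| n ^ s.
Proof.
have [gv gn] := great_coprime_divP; have g0 : 0 < g by exact: dvdn_gt0 gv.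
have w0 : 0 < v %/ g by rewrite divn_gt0 // dvdn_leq.
exists (v %/ g); apply/dvdn_partP => // p; rewrite mem_primes => /and3P[pp _ pw].
have pn : p %| n.
  apply: contraT => npn; have := @great_coprime_div_max (p * g).
  rewrite coprimeMl prime_coprime // npn gn -{1}(divnK gv) dvdn_pmul2r // pw.
  by move=> /(_ isT isT); rewrite leqNgt ltn_Pmull // prime_gt1.
rewrite p_part (dvdn_trans (dvdn_exp2r _ pn)) // dvdn_exp2l //.
by rewrite ltnW // ltn_logl.
Qed.

(** Fibre counts in the field involve (q-1)/m, the elementary tree only its factor nu; the remaining
    factor is coprime to [n] and invisible to these gcds. *)
Lemma gcdn_exp_great_coprime_div i : gcdn (n ^ i) (v %/ g) = gcdn (n ^ i) v.
Proof.
have [gv gn] := great_coprime_divP; rewrite -[v in RHS](divnK gv).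
by rewrite Gauss_gcdl // coprime_sym coprimeXr.
Qed.

End CoprimePart.

Lemma ord_modP N b : 0 < N -> coprime b N ->
  0 < ord_mod N b /\ b ^ ord_mod N b = 1 %[mod N].
Proof.
move=> N0 bN; rewrite /ord_mod; set s := filter _ _.
have ts : totient N \in s.
  rewrite mem_filter mem_iota totient_gt0 N0 add1n Euler_exp_totient // eqxx /=.
  rewrite !ltnS totient_count_coprime.
  rewrite big_mkord leqW // -[X in _ <= X]card_ord -sum1_card leq_sum // => i _.
  by case: coprime.
have : head 0 s \in s by case: s ts => //= x s _; rewrite mem_head.
by rewrite mem_filter mem_iota => /andP[/eqP-> /andP[-> _]].
Qed.

(** * Counting cycles of a permutation *)

Lemma iter_order_dvd (X : finType) (G : X -> X) (d : nat) (x : X) :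
  injective G -> (iter d G x == x) = (order G x %| d).
Proof.
move=> G_inj; have itM c : iter (c * order G x) G x = x.
  by elim: c => //= c IH; rewrite mulSn iterD IH iter_order.
rewrite {1}(divn_eq d (order G x)) addnC iterD itM /dvdn.
have lt : d %% order G x < order G x by rewrite ltn_mod order_gt0.
apply/eqP/eqP => [E|-> //].
by rewrite -(findex_iter lt) E findex0.
Qed.

Lemma iter_inj (X : Type) (G : X -> X) d : injective G -> injective (iter d G).
Proof. by move=> G_inj; elim: d => //= d IH x y /G_inj/IH. Qed.

Section CycleRepresentatives.
Variables (X : finType) (G : X -> X) (B : {set X}).
Hypotheses (G_inj : injective G) (G_stable : {homo G : x / x \in B}).

Definition exact_period u : {set X} := [set x in B | order G x == u].
Definition period_reps u : {set X} := [set x in exact_period u | froots G x].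

Lemma iter_stable_set d x : x \in B -> iter d G x \in B.
Proof. by move=> xB; elim: d => //= d; apply: G_stable. Qed.

Lemma order_iter d x : order G (iter d G x) = order G x.
Proof.
rewrite /order; apply: eq_card => y; rewrite !inE.
apply: same_connect; first exact: fconnect_sym.
by rewrite (fconnect_sym G_inj) fconnect_iter.
Qed.

Lemma exact_period_iter u d x : x \in exact_period u -> iter d G x \in exact_period u.
Proof.
by rewrite !inE => /andP[xB /eqP <-]; rewrite order_iter eqxx iter_stable_set.
Qed.

Lemma card_period_reps u : #|period_reps u| * u = #|exact_period u|.
Proof.
rewrite -(@fcard_order_set _ _ G_inj u (mem (exact_period u))) /=.
- congr (_ * _); rewrite /n_comp_mem; apply: eq_card => x.
  by rewrite !inE andbC.
- by apply/subsetP => x; rewrite !inE => /andP[].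
apply: (intro_closed (fconnect_sym G_inj)) => x y /eqP <-.
exact: (@exact_period_iter u 1).
Qed.

(** A point is fixed by the [d]-th iterate exactly when its period divides [d]; sorting by period
    yields the divisor sum to be inverted. *)
Lemma card_iter_fixed d : 0 < d ->
  #|[set x in B | iter d G x == x]| = \sum_(e <- divisors d) #|exact_period e|.
Proof.
have cardE (P : pred X) : #|[set x in B | P x]| = \sum_(x in B) P x.
  rewrite -sum1_card (eq_bigl (fun x => (x \in B) && P x)) => [|x]; last by rewrite inE.
  by rewrite big_mkcondr /=; apply: eq_bigr => x _; case: (P x).
move=> d0; rewrite cardE; under [RHS]eq_bigr do rewrite cardE.
rewrite exchange_big /=; apply: eq_bigr => x _.
rewrite iter_order_dvd // dvdn_divisors // -count_uniq_mem ?divisors_uniq //.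
by rewrite -sum1_count big_mkcond /=; apply: eq_bigr => e _; rewrite eq_sym; case: eqP.
Qed.

End CycleRepresentatives.

Local Open Scope ring_scope.

(** * Roots of unity in a finite field *)

Section PrimitiveRoot.
Variables (F : finFieldType) (N : nat) (alpha : F).
Hypothesis prim : N.-primitive_root alpha.

Lemma prim_root_neq0 : alpha != 0.
Proof.
apply/eqP => a0; have /eqP := prim_expr_order prim.
by rewrite a0 expr0n gtn_eqF ?(prim_order_gt0 prim) // eq_sym oner_eq0.
Qed.

Lemma prim_exprz_eq1 (z : int) : (alpha ^ z == 1) = (N%:Z %| z)%Z.
Proof.
have E j : (alpha ^+ j == 1) = (N%:Z %| j%:Z)%Z by rewrite -(prim_order_dvd prim).
case: z => j; first by rewrite -exprnP E.
by rewrite NegzE -exprz_inv -exprnP exprVn invr_eq1 E rpredN.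
Qed.

Lemma card_roots_of_unity d : (d %| N)%N -> #|[set z : F | z ^+ d == 1]| = d.
Proof.
move=> dN; have primd := dvdn_prim_root prim dN.
set z := alpha ^+ _ in primd.
have -> : [set x : F | x ^+ d == 1] = [set z ^+ (i : 'I_d) | i in 'I_d].
  apply/setP => x; rewrite inE; apply/eqP/imsetP => [/(prim_rootP primd)[i ->]|[i _ ->]].
    by exists i.
  by rewrite exprAC (prim_expr_order primd) expr1n.
rewrite card_imset ?card_ord // => i j /eqP.
by rewrite (eq_prim_root_expr primd) !modn_small // => /eqP/val_inj.
Qed.

Lemma card_common_roots_of_unity M b : (M %| N)%N ->
  #|[set z : F | (z ^+ M == 1) && (z ^+ b == 1)]| = gcdn M b.
Proof.
move=> MN; rewrite -[RHS]card_roots_of_unity; last exact: dvdn_trans (dvdn_gcdl _ _) MN.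
apply: eq_card => z; rewrite !inE; apply/andP/idP => [[zM zb]|zg]; last first.
  have zdvd c : (gcdn M b %| c)%N -> z ^+ c == 1.
    by case/dvdnP => c' ->; rewrite mulnC exprM (eqP zg) expr1n.
  by rewrite !zdvd ?dvdn_gcdl ?dvdn_gcdr.
have /(prim_rootP prim)[i zi] : z ^+ N = 1.
  by rewrite -(divnK MN) mulnC exprM (eqP zM) expr1n.
move: zM zb; rewrite zi -!exprM -!(prim_order_dvd prim) => h1 h2.
by rewrite muln_gcdr dvdn_gcd h1.
Qed.

End PrimitiveRoot.

(** With a = r + m s, the second condition becomes the single congruence s (A m) = -(c + r A) modulo
    [N]. *)
Lemma linear_congruence_solvable (N m A : nat) (r c : int) :
  (exists a : int, (m%:Z %| a - r)%Z /\ (N%:Z %| a * A%:Z + c)%Z) <->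
  ((gcdn N (A * m))%:Z %| c + r * A%:Z)%Z.
Proof.
split=> [[a [/dvdzP[b Eb] Na]]|].
  have -> : c + r * A%:Z = (a * A%:Z + c) - b * (A * m)%N%:Z.
    by rewrite PoszM -(subrK r a) Eb; ring.
  rewrite rpredB ?dvdz_mull //.
    by apply: dvdz_trans Na; rewrite dvdzE /= dvdn_gcdl.
  by rewrite dvdzE /= dvdn_gcdr.
case/dvdzP => w Ew; have [u [v Euv]] := Bezoutz N (A * m)%N.
have {}Euv : u * N%:Z + v * (A * m)%N%:Z = (gcdn N (A * m))%:Z by rewrite Euv.
(* This is s = - w v, with [v] the Bezout coefficient of A m. *)
exists (r - w * v * m%:Z); split.
  by rewrite addrAC subrr add0r rpredN dvdz_mull.
have -> : (r - w * v * m%:Z) * A%:Z + c = (w * u) * N%:Z.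
  by move: Euv Ew; rewrite PoszM => <- Ew; rewrite -[c](addrK (r * A%:Z)) Ew; ring.
by rewrite dvdz_mull.
Qed.

(** * The dynamics of x^n h(x^((q-1)/m)) *)

Lemma iter_modn (X : Type) (g : X -> X) (k a : nat) (x : X) :
  iter k g x = x -> iter (a %% k) g x = iter a g x.
Proof.
move=> kx; rewrite {2}(divn_eq a k) addnC iterD; congr iter.
by elim: (a %/ k)%N => //= c IH; rewrite mulSn iterD -IH.
Qed.

Section CycleOn.
Variables (X : finType) (g : X -> X) (S : {set X}) (k : nat).
Hypothesis cyc : is_cycle_on g S k.

Lemma cycle_on_len_gt0 : (0 < k)%N.
Proof. by case: cyc. Qed.

Lemma cycle_on_stable x : x \in S -> g x \in S.
Proof.
case: cyc => k0 [_ [x0 _ [kx0 ->]]] /imsetP[j _ ->]; rewrite -iterS.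
rewrite -(iter_modn _ kx0); apply/imsetP.
by exists (Ordinal (ltn_pmod j.+1 k0)).
Qed.

Lemma cycle_on_iter x : x \in S -> iter k g x = x.
Proof.
case: cyc => k0 [_ [x0 _ [kx0 ->]]] /imsetP[j _ ->].
by rewrite -iterD addnC iterD kx0.
Qed.

Lemma cycle_on_trans x y : x \in S -> y \in S -> exists2 a, (a < k)%N & iter a g x = y.
Proof.
move=> xS yS; have kx := cycle_on_iter xS.
suff [a <-] : exists a, iter a g x = y.
  by exists (a %% k)%N; [rewrite ltn_mod cycle_on_len_gt0 | rewrite iter_modn].
case: cyc xS yS => k0 [_ [x0 _ [kx0 ->]]] /imsetP[i _ ->] /imsetP[j _ ->].
exists (j + (k - i))%N; rewrite -iterD -addnA subnK 1?ltnW ?ltn_ord //.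
by rewrite iterD kx0.
Qed.

(** As [S] has [k] elements, the first [k] iterates of [x] are distinct, so [a] modulo [k] must be
    0. *)
Lemma cycle_on_period x a : x \in S -> iter a g x = x -> (k %| a)%N.
Proof.
move=> xS ax; have kx := cycle_on_iter xS.
have S_im : S = [set iter (j : 'I_k) g x | j in 'I_k].
  apply/setP => y; apply/idP/imsetP => [yS|[j _ ->]].
    by have [b bk <-] := cycle_on_trans xS yS; exists (Ordinal bk).
  by elim: (val j) => //= i; apply: cycle_on_stable.
have Sk : #|S| = k by case: cyc => _ [].
have /imset_injP inj : #|[set iter (j : 'I_k) g x | j in 'I_k]| == #|'I_k|.
  by rewrite -S_im Sk card_ord.
have k0 := cycle_on_len_gt0; rewrite /dvdn.
have := inj (Ordinal (ltn_pmod a k0)) (Ordinal k0) isT isT.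
by rewrite /= iter_modn // ax => /(_ erefl)/(congr1 val)/= ->.
Qed.

End CycleOn.

(** The quotient is 1 + b + ... + b^(d-1) in closed form; this is Horner's rule for it. *)
Lemma divn_predn_expS b d : (1 < b)%N ->
  ((b ^ d.+1 - 1) %/ (b - 1) = (b ^ d - 1) %/ (b - 1) * b + 1)%N.
Proof.
move=> b1; have b0 : (0 < b.-1)%N by rewrite -subn1 subn_gt0.
rewrite !subn1 !predn_exp !mulKn // big_ord_recl expn0 addnC big_distrl /=.
by congr addn; apply: eq_bigr => i _; rewrite -expnSr.
Qed.

Section Dynamics.
Variables (F : finFieldType) (alpha : F) (m n : nat) (h : {poly F}) (f : F -> F).
Variables (t : nat) (S : 'I_t -> {set F}) (k : 'I_t -> nat).
Let N := #|F|.-1.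
Let M := (N %/ m)%N.
Let psi := psi n h m.
Hypothesis prim : N.-primitive_root alpha.
Hypothesis m_dvd : (m %| N)%N.
Hypothesis n_gt1 : (1 < n)%N.
Hypothesis fE : forall x, f x = x ^+ n * h.[x ^+ M].
Hypothesis nice : m_nice n h m.
Hypothesis S_cover : forall x : F,
  (exists i, x \in S i) <-> (x \in mu F m /\ ~ psi_inf0 n h m x).
Hypothesis S_disjoint : forall i j, i != j -> [disjoint S i & S j].
Hypothesis S_cycle : forall i, is_cycle_on psi (S i) (k i).

Lemma N_gt0 : (0 < N)%N.
Proof. exact: prim_order_gt0 prim. Qed.

Lemma M_gt0 : (0 < M)%N.
Proof. by rewrite divn_gt0 ?(dvdn_leq N_gt0) // (dvdn_gt0 N_gt0). Qed.

Lemma M_dvd : (M %| N)%N.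
Proof. by apply/dvdnP; exists m; rewrite mulnC divnK. Qed.

Lemma mulMm : (M * m)%N = N.
Proof. exact: divnK. Qed.

Lemma expf_N (x : F) : x != 0 -> x ^+ N = 1.
Proof.
move=> x0; apply: (mulIf x0).
by rewrite -exprSr mul1r prednK ?expf_card // (cardD1 0).
Qed.

Lemma expM_mu (x : F) : x != 0 -> x ^+ M \in mu F m.
Proof. by move=> x0; rewrite inE -exprM mulMm expf_N. Qed.

Lemma power_semiconj x : f x ^+ M = psi (x ^+ M).
Proof. by rewrite fE /psi /Defs.psi exprMn exprAC. Qed.

Lemma iter_power_semiconj j x : iter j f x ^+ M = iter j psi (x ^+ M).
Proof. by elim: j => //= j IH; rewrite power_semiconj IH. Qed.

Lemma map0 : f 0 = 0.
Proof. by rewrite fE expr0n gtn_eqF ?mul0r // ltnW. Qed.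

Lemma S_psi i x : x \in S i -> psi x \in S i.
Proof. exact: cycle_on_stable. Qed.

Lemma S_mu i x : x \in S i -> x \in mu F m.
Proof. by move=> xS; have [] := (S_cover x).1 (ex_intro _ i xS). Qed.

Lemma mu_neq0 (x : F) : x \in mu F m -> x != 0.
Proof.
rewrite inE; apply: contraTneq => ->.
by rewrite expr0n gtn_eqF ?(dvdn_gt0 N_gt0) // eq_sym oner_eq0.
Qed.

Lemma S_neq0 i x : x \in S i -> x != 0.
Proof. by move/S_mu/mu_neq0. Qed.

Lemma S_uniq i j x : x \in S i -> x \in S j -> i = j.
Proof.
move=> xi xj; apply/eqP; apply: contraT => /S_disjoint/disjointFr/(_ xi).
by rewrite xj.
Qed.

(** * Vertices outside the component of 0 *)

Definition domain : {set F} := [set x | [exists i, x ^+ M \in S i]].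

Lemma domainP x : reflect (exists i, x ^+ M \in S i) (x \in domain).
Proof. by rewrite inE; apply: existsP. Qed.

Lemma domain_neq0 x : x \in domain -> x != 0.
Proof.
case/domainP => i /S_neq0; apply: contraNneq => ->.
by rewrite expr0n gtn_eqF ?M_gt0.
Qed.

Lemma in_domain x : x \in mu F m -> ~ psi_inf0 n h m x -> exists i, x \in S i.
Proof. by move=> x1 x2; apply/S_cover. Qed.

Lemma domain_stable x : (f x \in domain) = (x \in domain).
Proof.
apply/domainP/domainP => -[i]; rewrite power_semiconj; last first.
  by move=> xS; exists i; apply: S_psi.
have [->|x0] := eqVneq x 0.
  rewrite -power_semiconj map0 expr0n gtn_eqF ?M_gt0 // => /S_neq0.
  by rewrite eqxx.
move=> fS; apply: in_domain; first exact: expM_mu.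
(* The first step does not reach 0, as its value lies in [S i]; a later one would put that value in
   [psi_inf0]. *)
case=> _ [[|[|j]] [//= _ j0]].
  by move: (S_neq0 fS); rewrite /psi j0 eqxx.
have [_ []] := (S_cover _).1 (ex_intro _ i fS).
split; first exact: S_mu fS.
by exists j.+1; split=> //; rewrite -iterSr.
Qed.

(** [domain] is invariant forwards and backwards and misses 0, so no undirected path joins it to 0.
    For a nonzero [x] outside it, the orbit of x^M under [psi] reaches 0, hence so does that of [x]
    under [f]. *)
Lemma wconnect_domain x : wconnect f x 0 = (x \notin domain).
Proof.
apply/idP/idP => [x0|].
  rewrite (closed_connect (a := domain) _ x0).
    by apply/negP => /domain_neq0; rewrite eqxx.
  by move=> y z /orP[]/eqP <-; rewrite domain_stable.
apply: contraR => nx0; have iter_connect j : wconnect f x (iter j f x).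
  elim: j => [|j IH] /=; first exact: connect0.
  by apply: connect_trans IH (connect1 _); rewrite /= eqxx.
have xn0 : x != 0 by apply: contraNneq nx0 => ->; apply: connect0.
apply/domainP/in_domain; first exact: expM_mu.
case=> _ [j [_ j0]]; move: nx0; have := iter_connect j.
have -> : iter j f x = 0.
  by apply/eqP; move: j0; rewrite -iter_power_semiconj => /eqP; rewrite expf_eq0 => /andP[].
by move=> ->.
Qed.

(** Niceness enters here: [psi] is injective on the points of mu_m that it does not send to 0, and
    the sets [S i] consist of such points. *)
Lemma class_inj x x' : x \in domain -> x' \in domain ->
  f x ^+ M = f x' ^+ M -> x ^+ M = x' ^+ M.
Proof.
move=> /domainP[i xS] /domainP[j xS']; rewrite !power_semiconj => E.
apply: nice.2 E; rewrite inE.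
  by rewrite (S_mu xS) (S_neq0 (S_psi xS)).
by rewrite (S_mu xS') (S_neq0 (S_psi xS')).
Qed.

Lemma iter_mul_root j x z : z ^+ M = 1 -> iter j f (x * z) = iter j f x * z ^+ (n ^ j).
Proof.
move=> zM; elim: j => [|j IH]; first by rewrite expr1.
rewrite !iterS IH !fE !exprMn -!exprM -expnSr (mulnC (n ^ j)%N M).
by rewrite exprM zM expr1n mulr1 mulrAC.
Qed.

Lemma iter_class_inj j x x' : x \in domain -> x' \in domain ->
  iter j f x ^+ M = iter j f x' ^+ M -> x ^+ M = x' ^+ M.
Proof.
move=> xC xC'; elim: j => //= j IH E; apply: IH; apply: class_inj E.
  by rewrite (iter_stable domain_stable).
by rewrite (iter_stable domain_stable).
Qed.

Lemma card_mul_imset (A B : {set F}) w : w != 0 ->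
  (forall z, (w * z \in A) = (z \in B)) -> #|A| = #|B|.
Proof.
move=> w0 AB; have -> : A = [set w * z | z in B].
  apply/setP => x; apply/idP/imsetP => [xA|[z zB ->]]; last by rewrite AB.
  by exists (w^-1 * x); rewrite -?AB mulVKf.
by rewrite card_imset //; apply: mulfI.
Qed.

(* [z |-> iter i f (w * z)] maps the roots of unity [z] of order dividing both [M] and
   [n ^ i.+1] onto the fibre, and each of its own fibres is a coset of those of order
   dividing [M] and [n ^ i]. *)
Lemma card_domain_fiber i y : y \in depth_set f domain i.+1 ->
  #|[set z in depth_set f domain i | f z == y]| = gcdn_entry n M i.+1.
Proof.
case/depth_setP => w wC yE.
pose W j := [set z : F | (z ^+ M == 1) && (z ^+ (n ^ j) == 1)].
have cardW j : #|W j| = gcdn (n ^ j) M.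
  by rewrite gcdnC; apply: (card_common_roots_of_unity prim _ M_dvd).
have w0 := domain_neq0 wC.
have y0 : y != 0 by rewrite yE domain_neq0 // (iter_stable domain_stable).
set A := [set z in _ | _].
have wz_dom z : z ^+ M = 1 -> w * z \in domain.
  by move=> zM; apply/domainP; rewrite exprMn zM mulr1; apply/domainP.
suff E : #|W i.+1| = (#|A| * gcdn (n ^ i) M)%N.
  by rewrite /gcdn_entry -cardW E mulnK // gcdn_gt0 M_gt0 orbT.
pose phi z := iter i f (w * z).
rewrite -sum1_card (partition_big phi (mem A)) /=; last first.
  move=> z; rewrite !inE => /andP[/eqP zM /eqP zn]; apply/andP; split.
    by apply/depth_setP; exists (w * z) => //; apply: wz_dom.
  by rewrite /phi -iterS iter_mul_root // zn mulr1 yE.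
rewrite -sum_nat_const; apply: eq_bigr => x; rewrite inE.
case/andP=> /depth_setP[w' wC' xE] /eqP fx.
have Ew : w ^+ M = w' ^+ M.
  by apply: (iter_class_inj (j := i.+1)) => //; rewrite -yE -fx xE.
(* Multiplication by the quotient [e] maps [W i] onto the part of [W i.+1] that [phi] sends to
   [x]. *)
have [e w'E] : exists e, w' = w * e by exists (w' / w); rewrite mulrC divfK.
have eM : e ^+ M = 1.
  by apply: (mulfI (expf_neq0 M w0)); rewrite mulr1 -exprMn -w'E.
have e0 : e != 0.
  by apply: contraTneq (domain_neq0 wC') => e0; rewrite w'E e0 mulr0 eqxx.
have en : e ^+ (n ^ i.+1) = 1.
  apply: (mulfI y0); rewrite mulr1 {1}yE -iter_mul_root // -w'E iterS -xE fx.
  by [].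
rewrite sum1_card -cardW.
rewrite -(@card_mul_imset [set z in W i.+1 | phi z == x] (W i) e e0).
  by apply: eq_card => z; rewrite -topredE /= !inE.
have x0 : x != 0 by rewrite xE domain_neq0 // (iter_stable domain_stable).
move=> z; rewrite !inE; rewrite !exprMn eM en !mul1r.
case: eqP => //= zM; rewrite /phi mulrA -w'E iter_mul_root // -xE.
rewrite -[X in _ * _ == X](mulr1) (inj_eq (mulfI x0)) expnSr exprM.
by case: (z ^+ _ =P 1) => [->|]; rewrite ?andbF // expr1n eqxx.
Qed.


Let nu := (M %/ great_coprime_div n M)%N.
Let V := gcdn_seq n nu.

Lemma nu_gt0 : (0 < nu)%N.
Proof.
have [gM _] := great_coprime_divP n M_gt0.
by rewrite divn_gt0 ?(dvdn_leq M_gt0) // (dvdn_gt0 M_gt0).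
Qed.

Lemma size_V_gt0 : (0 < size V)%N.
Proof. by rewrite size_gcdn_seq gcdn_len_gt0 // nu_gt0. Qed.

Lemma V_last : vv V (size V) = 1%N.
Proof. by rewrite vv_gcdn_seq_last // nu_gt0. Qed.

Lemma card_fiber_vv i y : y \in depth_set f domain i.+1 ->
  #|[set z in depth_set f domain i | f z == y]| = vv V i.+1.
Proof.
move/card_domain_fiber ->; rewrite vv_gcdn_seq ?nu_gt0 // /gcdn_entry.
by rewrite !gcdn_exp_great_coprime_div ?M_gt0.
Qed.

Let K := core f domain V.
(** Extended by the identity outside [K], [f] becomes a permutation of the whole field, to which the
    cycle count for injective maps applies. *)
Definition core_map (x : F) : F := if x \in K then f x else x.

Lemma core_map_inj : injective core_map.
Proof.
have stable := core_stable domain_stable (V := V).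
have inj := core_inj size_V_gt0 V_last card_fiber_vv.
move=> x y; rewrite /core_map.
case: ifP => xK; case: ifP => yK // E; first exact: inj.
  by move: (stable x xK); rewrite -/K E yK.
by move: (stable y yK); rewrite -/K -E xK.
Qed.

Lemma iter_core x j : x \in K -> iter j f x \in K.
Proof. by move=> xK; elim: j => //= j; apply: core_stable domain_stable _. Qed.

Lemma iter_core_map x j : x \in K -> iter j core_map x = iter j f x.
Proof. by move=> xK; elim: j => //= j ->; rewrite /core_map iter_core. Qed.

Lemma iter_core_inj j x y : x \in K -> y \in K -> iter j f x = iter j f y -> x = y.
Proof. by move=> xK yK; rewrite -!iter_core_map //; apply/iter_inj/core_map_inj. Qed.

Lemma core_domain x : x \in K -> x \in domain.
Proof. exact: core_sub domain_stable _. Qed.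

(** * One cycle of psi: iterates, fixed points and periods *)

Section Component.
Variables (i : 'I_t) (xi lambda : F).
Hypothesis xi_S : xi \in S i.
Hypothesis lambdaE : lambda =
  \prod_(j < k i) (h.[iter j psi xi]) ^+ (n ^ (k i - j - 1)).
Let b := (n ^ k i)%N.

Lemma k_gt0 : (0 < k i)%N.
Proof. exact: cycle_on_len_gt0 (S_cycle i). Qed.

Lemma b_gt1 : (1 < b)%N.
Proof. by rewrite -(expn0 n) ltn_exp2l // k_gt0. Qed.

(** The values of [h] met along the orbit depend only on x^M; at j = k_i the product is [lambda]. *)
Lemma iter_formula j x : x ^+ M = xi ->
  iter j f x = x ^+ (n ^ j) * \prod_(c < j) (h.[iter c psi xi]) ^+ (n ^ (j - c - 1)).
Proof.
move=> xM; elim: j => [|j IH]; first by rewrite big_ord0 mulr1 expr1.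
rewrite iterS fE iter_power_semiconj xM IH exprMn -exprM -expnSr -mulrA.
congr (_ * _); rewrite big_ord_recr /= subSnn subnn expn0 expr1; congr (_ * _).
rewrite -prodrXl; apply: eq_bigr => c _; rewrite -exprM -expnSr.
by rewrite -!subnDA !addn1 subSn.
Qed.

Lemma iter_cycle_formula d x : x ^+ M = xi ->
  iter (d * k i) f x = x ^+ (b ^ d) * lambda ^+ ((b ^ d - 1) %/ (b - 1)).
Proof.
move=> xM; elim: d => [|d IH]; first by rewrite expn0 subnn div0n mulr1 expr1.
rewrite mulSn iterD iter_formula; last first.
  rewrite iter_power_semiconj xM mulnC.
  have kx := cycle_on_iter (S_cycle i) xi_S.
  by rewrite -(iter_modn _ kx) modnMr.
rewrite -lambdaE IH exprMn -!exprM divn_predn_expS ?b_gt1 //.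
by rewrite exprD expr1 mulrA -expnSr.
Qed.

Lemma class_period a x : x ^+ M = xi -> iter a f x ^+ M = xi -> (k i %| a)%N.
Proof.
by rewrite iter_power_semiconj => ->; apply: cycle_on_period (S_cycle i) _ _ xi_S.
Qed.

Lemma iter_cycle_class a x : x ^+ M = xi -> iter (a * k i) f x ^+ M = xi.
Proof.
move=> xM; rewrite iter_power_semiconj xM.
by rewrite -(iter_modn _ (cycle_on_iter (S_cycle i) xi_S)) modnMl.
Qed.

Lemma fiber_domain x : x ^+ M = xi -> x \in domain.
Proof. by move=> xM; apply/domainP; exists i; rewrite xM. Qed.

Section Count.
Variables (l r : int).
Hypothesis xiE : xi = alpha ^ (M%:Z * r).
Hypothesis lambda_l : alpha ^ l = lambda.

(** The point alpha^a lies over [xi] iff a = r modulo [m], and is then fixed iff a A + l B = 0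
    modulo [N]. Given one solution x0, the others are x0 z with z^M = z^A = 1, whence the gcd. *)
Lemma card_fixed d : (0 < d)%N ->
  #|[set x | (x ^+ M == xi) && (iter (d * k i) f x == x)]| =
  if ((gcdn N ((b ^ d - 1) * m))%:Z %|
       l * ((b ^ d - 1) %/ (b - 1))%N%:Z + r * (b ^ d - 1)%N%:Z)%Z
  then gcdn M (b ^ d - 1) else 0%N.
Proof.
move=> d0; set A := (b ^ d - 1)%N; set B := (A %/ (b - 1))%N; set Fx := [set x | _].
have alpha0 := prim_root_neq0 prim.
have AE : (A + 1)%N = (b ^ d)%N by rewrite subnK // expn_gt0 ltnW // b_gt1.
have FxE (a : int) : (alpha ^ a \in Fx) =
    (m%:Z %| a - r)%Z && (N%:Z %| a * A%:Z + l * B%:Z)%Z.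
  rewrite inE xiE.
  have -> : ((alpha ^ a) ^+ M == alpha ^ (M%:Z * r)) = (m%:Z %| a - r)%Z.
    rewrite -(inj_eq (mulIf (expfz_neq0 (- (M%:Z * r)) alpha0))).
    rewrite exprnP exprz_exp -!expfzDr // subrr expr0z (prim_exprz_eq1 prim).
    rewrite -mulMm (mulrC a) -mulrBr PoszM dvdz_mul2l //.
    by rewrite eqz_nat gtn_eqF // M_gt0.
  apply: andb_id2l => ar.
  have aM : (alpha ^ a) ^+ M = xi.
    apply/eqP; rewrite xiE; case/dvdzP: ar => c ac.
    rewrite -(inj_eq (mulIf (expfz_neq0 (- (M%:Z * r)) alpha0))).
    rewrite exprnP exprz_exp -!expfzDr // subrr expr0z (prim_exprz_eq1 prim).
    by rewrite -mulMm (mulrC a) -mulrBr ac PoszM mulrCA dvdz_mull.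
  rewrite iter_cycle_formula // -/A -/B -AE exprD expr1 -lambda_l mulrAC.
  rewrite -[X in _ == X]mul1r (inj_eq (mulIf (expfz_neq0 a alpha0))).
  by rewrite !exprnP !exprz_exp -expfzDr // (prim_exprz_eq1 prim).
rewrite addrC; have [Fx0|[x0 x0F]] := set_0Vmem Fx.
  rewrite Fx0 cards0; case: ifP => // dv.
  have [_ /(_ _)] := linear_congruence_solvable N m A r (l * B%:Z).
  rewrite [l * _ + _]addrC => /(_ dv)[a [a1 a2]].
  by have := FxE a; rewrite a1 a2 Fx0 inE.
have [x0M x0fix] : x0 ^+ M = xi /\ iter (d * k i) f x0 = x0.
  by move: x0F; rewrite inE => /andP[/eqP ? /eqP].
have x00 : x0 != 0 by apply: domain_neq0; apply: fiber_domain.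
have /(prim_rootP prim)[a x0a] : x0 ^+ N = 1 by apply: expf_N.
have [/(_ _) dv _] := linear_congruence_solvable N m A r (l * B%:Z).
rewrite addrC dv; last first.
  exists (a : nat)%:Z; apply/andP; rewrite -FxE -exprnP -x0a; exact: x0F.
rewrite -(card_common_roots_of_unity prim _ M_dvd).
apply: (card_mul_imset x00) => z; rewrite !inE exprMn x0M.
have xi0 : xi != 0 by apply: S_neq0 xi_S.
rewrite -[X in _ == X]mulr1 (inj_eq (mulfI xi0)); apply: andb_id2l => /eqP zM.
rewrite iter_mul_root // x0fix (inj_eq (mulfI x00)) mulnC expnM -/b -AE exprD expr1.
have z0 : z != 0.
  by apply: contraTneq (oner_neq0 F) => z0; rewrite -zM z0 expr0n gtn_eqF ?M_gt0 ?eqxx.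
by rewrite -[X in _ == X]mul1r (inj_eq (mulIf z0)).
Qed.

End Count.

Hypothesis lambda_neq0 : lambda != 0.
Let omega' := great_coprime_div n N.

Lemma ord_period_spec : (0 < ord_mod (omega' * (b - 1)) b)%N /\
  (b ^ ord_mod (omega' * (b - 1)) b = 1 %[mod omega' * (b - 1)])%N.
Proof.
have [wN wn] := great_coprime_divP n N_gt0.
apply: ord_modP.
  by rewrite muln_gt0 subn_gt0 b_gt1 (dvdn_gt0 N_gt0 wN).
rewrite coprimeMr coprime_sym coprimeXr //=.
by rewrite coprime_sym subn1 coprimePn // ltnW // b_gt1.
Qed.

(* The quotient [z] of the two sides has order dividing both [M] and [N / omega'], hence a
   power of [n]; so enough further steps of [f], which is injective on [K], kill it. *)
Lemma core_period_ord x : x \in K -> x ^+ M = xi ->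
  iter (ord_mod (omega' * (b - 1)) b * k i) f x = x.
Proof.
move=> xK xM; have [wN wn] := great_coprime_divP n N_gt0.
have w0 : (0 < omega')%N by apply: dvdn_gt0 wN; apply: N_gt0.
have b1 : (0 < b - 1)%N by rewrite subn_gt0 b_gt1.
have := ord_period_spec.2; set e := ord_mod _ _ => be.
have be1 : (0 < b ^ e)%N by rewrite expn_gt0 ltnW // b_gt1.
have dvB : (omega' %| (b ^ e - 1) %/ (b - 1))%N.
  rewrite dvdn_divRL; last by rewrite !subn1 predn_exp dvdn_mulr.
  by move/eqP: be; rewrite eqn_mod_dvd.
have x0 : x != 0 by apply/domain_neq0/core_domain.
set B := (_ %/ _)%N in dvB; pose z := (x ^+ (b - 1) * lambda) ^+ B.
have yz : iter (e * k i) f x = x * z.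
  rewrite iter_cycle_formula // -/B /z exprMn mulrA -exprM -exprS; congr (x ^+ _ * _).
  rewrite mulnC /B divnK; last by rewrite !subn1 predn_exp dvdn_mulr.
  by rewrite -addn1 subnK.
have [s ns] := great_coprime_div_cofactor n N_gt0.
(* [B] supplies the factor omega' of [N] and n^s its cofactor, so the total exponent is a multiple
   of [N]. *)
have zns : z ^+ (n ^ s) = 1.
  case/dvdnP: ns => c ->; rewrite /z -exprM; case/dvdnP: dvB => c' ->.
  rewrite (_ : (c' * omega' * _ = N * (c' * c))%N).
    by rewrite exprM expf_N ?expr1n // mulf_neq0 // expf_neq0.
  by rewrite -[in RHS](divnK wN) -/omega'; ring.
have zM : z ^+ M = 1.
  have xiN : xi != 0 by apply: S_neq0 xi_S.
  by apply: (mulfI xiN); rewrite mulr1 -{1}xM -exprMn -yz iter_cycle_class.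
apply: (iter_core_inj (j := s)) => //; first exact: iter_core.
by rewrite yz iter_mul_root // zns mulr1.
Qed.

End Component.

(** * One representative on each cycle *)

Section Representatives.
Variables (xi lambda : 'I_t -> F).
Hypothesis xi_S : forall i, xi i \in S i.
Hypothesis lambdaE : forall i, lambda i =
  \prod_(j < k i) (h.[iter j psi (xi i)]) ^+ (n ^ (k i - j - 1)).
Hypothesis lambda_neq0 : forall i, lambda i != 0.

(** On core points over [xi i] this is the first return to that fibre: a cycle of [f] of length k_i
    u over [S i] meets the fibre in one cycle of length u of this map. *)
Definition return_map i : F -> F := iter (k i) core_map.
Definition return_set i : {set F} := [set x in K | x ^+ M == xi i].
Definition reps i u : {set F} := period_reps (return_map i) (return_set i) u.
Let ordi i := ord_mod (great_coprime_div n N * (n ^ k i - 1)) (n ^ k i).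

Lemma return_map_inj i : injective (return_map i).
Proof. exact/iter_inj/core_map_inj. Qed.

Lemma iter_return_map i d x : x \in K -> iter d (return_map i) x = iter (d * k i) f x.
Proof.
move=> xK; rewrite -iter_core_map //.
by elim: d => //= d IH; rewrite mulSn iterD -IH.
Qed.

Lemma return_map_stable i : {homo return_map i : x / x \in return_set i}.
Proof.
move=> x; rewrite !inE => /andP[xK /eqP xM].
rewrite -[return_map i x]/(iter 1 (return_map i) x) iter_return_map // iter_core //=.
by rewrite (iter_cycle_class (xi_S i)).
Qed.

Lemma repsP i u x : x \in reps i u ->
  [/\ x \in K, x ^+ M = xi i, order (return_map i) x = u &
      froot (return_map i) x = x].
Proof. by rewrite !inE => /andP[/andP[/andP[-> /eqP->] /eqP->] /eqP->]. Qed.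

Lemma reps_cycle i u x : x \in reps i u -> iter (k i * u) f x = x.
Proof.
case/repsP=> xK _ <- _; rewrite mulnC -iter_return_map //.
exact/iter_order/return_map_inj.
Qed.

(** Cancelling [a] steps gives f^(a'-a)(x') = x. Both points lie over [xi i], so a' - a = d k_i and
    they share an orbit of the return map, hence its root; the bound on a' forces d = 0. *)
Lemma reps_inj i u u' x x' a a' : x \in reps i u -> x' \in reps i u' ->
  (a <= a')%N -> (a' < k i * u')%N -> iter a f x = iter a' f x' ->
  [/\ u = u', x = x' & a = a'].
Proof.
move=> /repsP[xK xM xu xr] /repsP[xK' xM' xu' xr'] aa' lt E.
have {}E : iter (a' - a) f x' = x.
  apply: (iter_core_inj (j := a)); rewrite ?iter_core //.
  by rewrite -iterD subnKC.
have := class_period (xi_S i) xM' (a := (a' - a)%N); rewrite E => /(_ xM)/dvdnP[d da].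
have Ed : iter d (return_map i) x' = x by rewrite iter_return_map // -da.
have symG := fconnect_sym (@return_map_inj i).
have xx' : x = x'.
  rewrite -xr -xr'; apply/esym/(fingraph.rootP symG).
  by rewrite -Ed fconnect_iter.
have uu' : u = u' by rewrite -xu -xu' xx'.
split=> //; have /eqP := Ed; rewrite {1}xx' iter_order_dvd; last exact: return_map_inj.
rewrite xu'; have du : (d < u')%N.
  rewrite -(ltn_pmul2r (k_gt0 i)) -da (leq_ltn_trans (leq_subr _ _)) // mulnC.
  exact: lt.
case: d du da {Ed} => [|d] du; last by move=> _ /(dvdn_leq (ltn0Sn d)); rewrite leqNgt du.
by move/eqP; rewrite mul0n subn_eq0 => a'a _; apply/eqP; rewrite eqn_leq aa'.
Qed.

Lemma reps_surj y : y \in K -> exists i u x, [/\ (0 < u)%N, (u %| ordi i)%N,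
  x \in reps i u & exists2 a, (a < k i * u)%N & iter a f x = y].
Proof.
move=> yK; have /domainP[i yS] := core_domain yK.
have [a _ ay] := cycle_on_trans (S_cycle i) yS (xi_S i).
set y1 := iter a f y; have y1K : y1 \in K by apply: iter_core.
have y1M : y1 ^+ M = xi i by rewrite iter_power_semiconj.
pose G := return_map i; have G_inj : injective G by apply: return_map_inj.
have y1B : y1 \in return_set i by rewrite inE y1K y1M eqxx.
pose u := order G y1; pose x := froot G y1.
have symG := fconnect_sym G_inj.
have cx : fconnect G y1 x by apply: connect_root.
have x_rep : x \in reps i u.
  rewrite inE (roots_root symG) andbT -(iter_findex cx).
  by apply: exact_period_iter => //; [apply: return_map_stable | rewrite inE y1B /=].
have u0 : (0 < u)%N by apply: order_gt0.
exists i, u, x; split=> //.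
  rewrite /u -iter_order_dvd // iter_return_map //; apply/eqP.
  exact: core_period_ord (xi_S i) (lambdaE i) (lambda_neq0 i) _ _ _.
have [xK xM xu xr] := repsP x_rep.
have xy1 : fconnect G x y1 by rewrite symG.
suff [e ey] : exists e, iter e f x = y.
  exists (e %% (k i * u))%N; first by rewrite ltn_mod muln_gt0 u0 k_gt0.
  by rewrite iter_modn // reps_cycle.
have [o o0 oy] : exists2 o, (0 < o)%N & iter o f y = y.
  exists (order f y); first exact: order_gt0.
  exact: (core_periodic domain_stable size_V_gt0 V_last card_fiber_vv yK).
(* From [x] the return map leads to y1 = f^a(y); as [o] is a period of [y], a o - a further steps
   lead back to [y]. *)
exists ((a * o - a) + findex G x y1 * k i)%N.
rewrite iterD -iter_return_map // iter_findex // /y1 -iterD subnK ?leq_pmulr //.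
by rewrite -(iter_modn _ oy) modnMl.
Qed.

(** Points of the domain fixed by an iterate belong to the core automatically, so the count extends
    to the whole fibre, where it is a congruence. *)
Lemma sum_exact_period i d : (0 < d)%N ->
  (\sum_(e <- divisors d) #|exact_period (return_map i) (return_set i) e|)%N =
  #|[set x | (x ^+ M == xi i) && (iter (d * k i) f x == x)]|.
Proof.
move=> d0; rewrite -(card_iter_fixed (return_set i) (@return_map_inj i) d0).
apply: eq_card => x; rewrite !inE -andbA; case xK: (x \in K) => /=.
  by rewrite iter_return_map.
apply/esym/negP => /andP[/eqP xM /eqP xfix]; move: xK.
rewrite (periodic_core V domain_stable _ _ xfix) ?muln_gt0 ?d0 ?k_gt0 //.
exact: fiber_domain (xi_S i) _ xM.
Qed.

Variable c : {i : 'I_t & 'I_(ordi i).+1} -> nat.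
Hypothesis cE : forall p, c p =
  if (0 < tagged p)%N && (tagged p %| ordi (tag p))%N
  then #|reps (tag p) (tagged p)| else 0%N.

Lemma fg_iso_dynamics : fg_iso (@induced (FGraph f) domain)
  (fg_sum (fun p => fg_copies (c p) (Cyc (k (tag p) * tagged p) (elem_tree V)))).
Proof.
pose base p (b : 'I_(c p)) : F := nth 0 (enum (reps (tag p) (tagged p))) b.
have bc p (b : 'I_(c p)) : c p = #|reps (tag p) (tagged p)|.
  by have := cE p; case: ifP => // _ E; case: b; rewrite E.
have b_lt p (b : 'I_(c p)) : (b < size (enum (reps (tag p) (tagged p))))%N.
  by rewrite -cardE -bc // ltn_ord.
have base_reps p (b : 'I_(c p)) : base p b \in reps (tag p) (tagged p).
  by rewrite -mem_enum mem_nth.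
have half (p : {i : 'I_t & 'I_(ordi i).+1}) (b : 'I_(c p)) a p' (b' : 'I_(c p')) a' :
    (a <= a')%N -> (a' < k (tag p') * tagged p')%N ->
    iter a f (base p b) = iter a' f (base p' b') ->
    existT (fun p => 'I_(c p)) p b = existT (fun p => 'I_(c p)) p' b' /\ a = a'.
  (* Orbits over different [S i] stay over disjoint sets. *)
  move=> aa' lt E; have Ei : tag p = tag p'.
    have [_ xM _ _] := repsP (base_reps p b).
    have [_ xM' _ _] := repsP (base_reps p' b').
    have inS i d x : x ^+ M = xi i -> iter d f x ^+ M \in S i.
      move=> xi_x; rewrite iter_power_semiconj xi_x.
      by elim: d => //= d; apply: S_psi.
    by apply: (S_uniq (inS _ a _ xM)); rewrite E; apply: inS.
  case: p p' Ei => [i u] [i' u'] /= Ei in b b' lt E *.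
  case: _ / Ei => {i'} in u' b' lt E *.
  have [Eu Ex ->] := reps_inj (base_reps _ b) (base_reps _ b') aa' lt E.
  split=> //; have {}Eu : u = u' by apply: ord_inj.
  subst u'.
  congr existT; apply/val_inj/eqP => /=.
  by move/eqP: Ex; rewrite /base nth_uniq ?enum_uniq ?b_lt.
apply: (@fg_iso_cycles _ f domain V domain_stable size_V_gt0 V_last card_fiber_vv
          _ c (fun p => k (tag p) * tagged p)%N base).
- by move=> p b; have [] := repsP (base_reps p b).
- by move=> p b; apply: reps_cycle.
- move=> p b a p' b' a' lt lt' E; case/orP: (leq_total a a') => aa'.
    exact: half.
  by have [-> ->] := half _ _ _ _ _ _ aa' lt (esym E).
move=> y /reps_surj[i [u [x [u0 uo xr [a au ay]]]]].
have uo1 : (u < (ordi i).+1)%N.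
  by rewrite ltnS dvdn_leq //; case: (ord_period_spec i).
pose p : {i : 'I_t & 'I_(ordi i).+1} := existT _ i (Ordinal uo1).
have xc : (index x (enum (reps i u)) < c p)%N.
  by rewrite cE /= u0 uo cardE index_mem mem_enum.
exists p, (Ordinal xc), a => //.
by rewrite /base /= nth_index // mem_enum.
Qed.

End Representatives.
End Dynamics.

Unset Implicit Arguments.
Set Strict Implicit.
Set Printing Implicit Defensive.

Theorem theorem2p7 (F : finFieldType) (alpha : F) (m n : nat) (h : {poly F})
  (f : {poly F})
  (t : nat) (S : 'I_t -> {set F}) (k : 'I_t -> nat) (xi : 'I_t -> F)
  (l r : 'I_t -> int) :
  let q := #|F| in
  (q.-1).-primitive_root alpha ->
  (0 < m)%N -> (m %| q.-1)%N ->
  (1 < n)%N ->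
  index_rep f n h m ->
  m_nice n h m ->
  (forall x : F, (exists i, x \in S i) <-> (x \in mu F m /\ ~ psi_inf0 n h m x)) ->
  (forall i j, i != j -> [disjoint S i & S j]) ->
  (forall i, is_cycle_on (psi n h m) (S i) (k i)) ->
  (forall i, xi i \in S i) ->
  (forall i, xi i = alpha ^ ((q.-1 %/ m)%:Z * r i)) ->
  (forall i, alpha ^ (l i) =
     \prod_(j < k i) (h.[iter j (psi n h m) (xi i)]) ^+ (n ^ (k i - j - 1))) ->
  let omega := great_coprime_div n (q.-1 %/ m) in
  let nu := (q.-1 %/ m %/ omega)%N in
  let omega' := great_coprime_div n q.-1 in
  let ordi := fun i => ord_mod (omega' * (n ^ k i - 1)) (n ^ k i) in
  let tau := fun (i : 'I_t) (d : nat) =>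
    if ((gcdn q.-1 ((n ^ (d * k i) - 1) * m))%:Z %|
          l i * ((n ^ (d * k i) - 1) %/ (n ^ k i - 1))%N%:Z
          + r i * (n ^ (d * k i) - 1)%N%:Z)%Z
    then gcdn (q.-1 %/ m) (n ^ (d * k i) - 1) else 0%N in
  let Ssum := fun (i : 'I_t) (u : nat) =>
    \sum_(d <- divisors u) moebius (u %/ d) * (tau i d)%:Z in
  let mult := fun (i : 'I_t) (u : nat) =>
    if (0 < u)%N && (u %| ordi i)%N then absz (Ssum i u %/ u%:Z)%Z else 0%N in
  (forall (i : 'I_t) (u : nat), (0 < u)%N -> (u %| ordi i)%N ->
     (u%:Z %| Ssum i u)%Z /\ 0 <= Ssum i u) /\
  fg_iso (G1 f)
    (fg_sum (fun p : {i : 'I_t & 'I_(ordi i).+1} =>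
       fg_copies (mult (tag p) (tagged p))
                 (Cyc (k (tag p) * tagged p) (elem_tree (gcdn_seq n nu))))).
Proof.
move=> q prim m0 mN n1 [form _] nice cover disj cyc xiS xiE lamE.
move=> omega nu omega' ordi tau Ssum mult.
pose g x := f.[x]; pose lambda i := alpha ^ l i.
have fE x : g x = x ^+ n * h.[x ^+ (q.-1 %/ m)].
  case: form => _ _ _; rewrite /g => {1}->.
  by rewrite hornerM hornerXn horner_comp hornerXn.
have lambda0 i : lambda i != 0 by rewrite expfz_neq0 // (prim_root_neq0 prim).
pose ep i u := exact_period (return_map m n g S k i) (return_set m n g S xi i) u.
(* Inversion turns the fixed-point counts [tau i d] into the number of points of exact period [u],
   which is nonnegative and, one cycle having [u] points, divisible by [u]. *)
have SsumE i u : (0 < u)%N -> Ssum i u = #|ep i u|%:Z.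
  move=> u0; rewrite -(moebius_inversion (fun e => #|ep i e|%:Z) u0) /Ssum.
  apply: eq_big_seq => d; rewrite -dvdn_divisors // => du; congr (_ * _).
  have d0 := dvdn_gt0 u0 du.
  have := sum_exact_period prim mN n1 fE nice cover cyc xiS i d0.
  rewrite (card_fixed prim mN n1 fE cover cyc (xiS i) (lamE i) (xiE i) erefl d0).
  by rewrite -expnM (mulnC (k i)) /tau => <-; rewrite (big_morph Posz PoszD (erefl _)).
have repsE i u : (#|reps m n g S k xi i u| * u)%N = #|ep i u|.
  apply: card_period_reps;
    last exact: (return_map_stable prim mN n1 fE cover cyc xiS).
  exact: (return_map_inj prim mN n1 fE nice cover cyc).
split.
  move=> i u u0 _; rewrite SsumE // -repsE PoszM; split=> //.
  by rewrite dvdz_mull.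
rewrite /G1.
have -> : [set x | ~~ wconnect (fun a : F => f.[a]) x 0] = domain m S.
  apply/setP => x; rewrite inE (wconnect_domain prim mN n1 fE cover cyc).
  by rewrite negbK.
apply: (fg_iso_dynamics prim mN n1 fE nice cover disj cyc xiS lamE lambda0) => -[i u].
rewrite /mult /=; case: ifP => // /andP[u0 _].
by rewrite SsumE // -repsE PoszM mulzK // eqz_nat -lt0n.
Qed.
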